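(* Let $\mathfrak{f}$ be a definite Demoulin surface in $\mathbb{RP}^3$ and let $g_1:\mathbb{D}\to\mathcal{Q}\cong G/K_1$ be its first-order Gauss map (which is conformal and harmonic). Then $g_1$ is obtained by the homogeneous projection of a primitive map into the regular semi-Riemannian $6$-symmetric space $G/K\cong\mathrm{SL}_4\mathbb{R}/(\mathrm{SO}_{1,1}\times\mathrm{SO}_2)$: there exists a primitive map $\psi:\mathbb{D}\to G/K$ such that, under the identification $G/K_1\cong\mathcal{Q}$, $gK_1\mapsto LgJ_1g^{\mathrm T}L^{\mathrm T}$, one has $g_1=\pi\circ\psi$, where $\pi:G/K\to G/K_1$, $gK\mapsto gK_1$.
   Context: **Surface and canonical system.** Let $\mathfrak{f}:M\to\mathbb{RP}^3$ be an immersed surface and $f$ a local lift to $\mathbb{R}^4\setminus\{0\}$. Write $D$ for the flat connection of $\mathbb{R}^4$, $\zeta$ for the radial vector field, and $\xi$ for a vector field along $f$ transversal to the span of $\zeta$ and $df(TM)$. The Gauss formula $D_X f_*Y=f_*(\nabla_XY)+h(X,Y)\xi+T(X,Y)\zeta$ defines a symmetric form $h$ whose conformal class $[h]$ (up to sign) depends only on $\mathfrak{f}$. It is assumed that $h$ is definite (positive definite after choosing the sign of $\xi$), and $M$ is a Riemann surface with conformal structure $[h]$. Let $\mathbb{D}\subset M$ be a simply connected (connected) domain with complex coordinate $z$. There is a lift $f:\mathbb{D}\to\mathbb{R}^4\setminus\{0\}$, unique up to a constant factor, satisfying the canonical system $$f_{zz}=b f_{\bar z}+pf,\qquad f_{\bar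 z\bar z}=\bar b f_z+\bar p f$$ for smooth complex functions $b,p$. The projective metric of $\mathfrak{f}$ is $8|b|^2dz\,d\bar z$. It is assumed positive definite, i.e. the symmetric form $h$ defined by the Gauss formula $D_X f_*Y=f_*(\nabla_XY)+h(X,Y)\xi+T(X,Y)\zeta$ is definite (positive definite after choosing the sign of $\xi$) and $b$ vanishes nowhere. All objects below are considered on $\mathbb{D}$. **Invariants.** Set $$k=\tfrac12\left(|b|^2-(\log b)_{z\bar z}\right),\qquad P=p+\frac{b_{\bar z}}{2}-\frac{\bar b_{zz}}{2\bar b}+\frac{\bar b_z^2}{4\bar b^2}.$$ The surface (with positive definite projective metric) is a *definite Demoulin surface* if $P=0$ identically. **Wilczynski frame.** Let $$U=\begin{pmatrix}\frac{\bar b_z}{2\bar b}&P&k&b\bar P\\1&-\frac{\bar b_z}{2\bar b}&0&k\\0&b&\frac{\bar b_z}{2\bar b}&P\\0&0&1&-\frac{\bar b_z}{2\bar b}\end{pmatrix},\qquad V=\begin{pmatrix}\frac{b_{\bar z}}{2b}&\bar k&\bar P&\bar bP\\0&\frac{b_{\bar z}}{2b}&\bar b&\bar P\\1&0&-\frac{b_{\bar z}}{2b}&\bar k\\0&1&0&-\frac{b_{\bar z}}{2b}\end{pmatrix}.$$ The Wilczynski frame $F=(f,f_1,f_2,\eta)$, where $f_1=f_z-\frac{\bar b_z}{2\bar b}f$, $f_2=f_{\bar z}-\frac{b_{\bar z}}{2b}f$, $\eta=f_{z\bar z}-\frac{\bar b_z}{2\bar b}f_{\bar z}-\frac{b_{\bar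 z}}{2b}f_z+\left(\frac{|b_{\bar z}|^2}{4|b|^2}-\frac{|b|^2}{2}\right)f$, satisfies $F_z=FU$, $F_{\bar z}=FV$. From now on $F$ denotes the solution of $F_z=FU$, $F_{\bar z}=FV$ normalized by $F(z_* )=\mathrm{id}$ at a base point $z_*\in\mathbb{D}$ (this changes the frame by left multiplication by a constant matrix). With $$L=\frac1{\sqrt2}\begin{pmatrix}\sqrt2&0&0&0\\0&\sqrt{-1}&-\sqrt{-1}&0\\0&1&1&0\\0&0&0&\sqrt2\end{pmatrix},$$ the matrix $\hat F=LFL^{-1}$ takes values in $\mathrm{SL}_4\mathbb{R}$. Put $G=L^{-1}\,\mathrm{SL}_4\mathbb{R}\,L\subset\mathrm{SL}_4\mathbb{C}$, with Lie algebra $\mathfrak g$ and $\mathfrak g^{\mathbb C}=\mathfrak{sl}_4\mathbb{C}$; so $F$ is $G$-valued. **Gauss map and $\mathcal{Q}$.** Let $J_1$ be the $4\times4$ antidiagonal matrix with all antidiagonal entries $1$, and $$\hat J_1=LJ_1L^{\mathrm T}=\begin{pmatrix}0&0&0&1\\0&1&0&0\\0&0&1&0\\1&0&0&0\end{pmatrix}.$$ Let $\mathcal{Q}$ be the space of real symmetric $4\times4$ matrices of determinant $-1$ with three positive and one negative eigenvalue; it is the orbit of $\hat J_1$ under the $\mathrm{SL}_4\mathbb{R}$-action $(g,Q)\mapsto gQg^{\mathrm T}$, with invariant semi-Riemannian metric $\langle X,Y\rangle_Q=\mathrm{Tr}(Q^{-1}XQ^{-1}Y)$. With $K_1=\{a\in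 G\mid aJ_1a^{\mathrm T}=J_1\}$, the map $gK_1\mapsto LgJ_1g^{\mathrm T}L^{\mathrm T}$ identifies $G/K_1$ with $\mathcal{Q}$. The *first-order Gauss map* is $g_1=\hat F\hat J_1\hat F^{\mathrm T}=LFJ_1F^{\mathrm T}L^{\mathrm T}:\mathbb{D}\to\mathcal{Q}$. *Conformal* means $\langle\partial_zg_1,\partial_zg_1\rangle=0$ (metric extended complex bilinearly); *harmonic* means vanishing tension field. **The $6$-symmetric space.** Let $\tau_1(a)=J_1(a^{\mathrm T})^{-1}J_1$ and $\sigma(a)=EaE^{-1}$ on $G$, with $E=\mathrm{diag}(1,\epsilon^2,\epsilon,1)$, $\epsilon=e^{2\pi\sqrt{-1}/3}$. These preserve $G$ and commute; $\kappa=\tau_1\circ\sigma$ is an automorphism of $G$ of order $6$ with fixed point group $$K=\{\mathrm{diag}(k_1,k_2,k_2^{-1},k_1^{-1})\mid k_1\in\mathbb{R}^\times,\ k_2\in\mathbb{S}^1\}\cong\mathrm{SO}_{1,1}\times\mathrm{SO}_2 .$$ In general, for a semisimple real Lie group $G$ with automorphism $\tau$ of order $m\ge2$, a *regular semi-Riemannian $m$-symmetric space* is a reductive homogeneous space $G/K$ with $G_\tau^\circ\subset K\subset G_\tau$ ($G_\tau$ the fixed point group of $\tau$, $G_\tau^\circ$ its identity component), with $G$-invariant semi-Riemannian metric induced by a constant multiple of the Killing form, such that the Lie algebra $\mathfrak k$ of $K$ is non-degenerate. Here $\tau=\kappa$, $m=6$. **Primitive maps.** Let $\omega=-\epsilon$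 (a primitive $6$th root of unity) and let $\mathfrak g^{\mathbb C}_j$, $j\in\mathbb{Z}_6$, be the eigenspace of the differential of $\kappa$ on $\mathfrak g^{\mathbb C}$ with eigenvalue $\omega^j$; thus $\mathfrak g_0^{\mathbb C}=\mathfrak k^{\mathbb C}$. Let $[\mathfrak g^{\mathbb C}_j]$ be the bundle over $G/K$ with fiber $\mathrm{Ad}(g)\mathfrak g^{\mathbb C}_j$ at $gK$; via the infinitesimal action, $T^{\mathbb C}(G/K)=\bigoplus_{j\ne0}[\mathfrak g_j^{\mathbb C}]$. A smooth map $\psi$ from a Riemann surface $\varSigma$ to $G/K$ is *primitive* if $d\psi(T'\varSigma)\subset[\mathfrak g^{\mathbb C}_{-1}]$, where $T'\varSigma$ is the $(1,0)$-tangent bundle. *)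

(* Defs.v *)
From HB Require Import structures.
From mathcomp Require Import all_boot all_order all_algebra.
From mathcomp Require Import all_classical all_reals all_analysis.
From mathcomp Require Import complex.
Set Implicit Arguments.
Unset Strict Implicit.
Unset Printing Implicit Defensive.
Import Order.TTheory GRing.Theory Num.Theory.
Import numFieldNormedType.Exports.
Local Open Scope classical_set_scope.
Local Open Scope ring_scope.
Local Open Scope complex_scope.

(* The plane is R * R, the point (x, y) standing for z = x + iy. *)

Definition dir (R : realType) (i : 'I_2) : R * R :=
  if i == 0 then (1, 0) else (0, 1).

Definition pd (R : realType) (i : 'I_2) (u : R * R -> R) : R * R -> R :=
  fun q => 'D_(dir R i) u q.

Fixpoint Cn (R : realType) (n : nat) (D : set (R * R)) (u : R * R -> R) : Prop :=
  match n with
  | 0 => forall q, D q -> {for q, continuous u}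
  | n'.+1 => (forall q, D q -> differentiable u q) /\
             forall i : 'I_2, Cn n' D (pd i u)
  end.

(* C^oo on D, meant for open D *)
Definition smooth (R : realType) (D : set (R * R)) (u : R * R -> R) : Prop :=
  forall n, Cn n D u.

Definition smoothc (R : realType) (D : set (R * R)) (u : R * R -> R[i]) : Prop :=
  smooth D (fun w => complex.Re (u w)) /\ smooth D (fun w => complex.Im (u w)).

Definition smoothm (R : realType) m n (D : set (R * R))
    (A : R * R -> 'M[R]_(m, n)) : Prop :=
  forall i j, smooth D (fun w => A w i j).

Definition smoothcm (R : realType) m n (D : set (R * R))
    (A : R * R -> 'M[R[i]]_(m, n)) : Prop :=
  forall i j, smoothc D (fun w => A w i j).

Definition pdm (R : realType) m n (k : 'I_2) (A : R * R -> 'M[R]_(m, n)) :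
    R * R -> 'M[R]_(m, n) :=
  fun q => \matrix_(i, j) pd k (fun w => A w i j) q.

Definition cpd (R : realType) (k : 'I_2) (u : R * R -> R[i]) : R * R -> R[i] :=
  fun q => pd k (fun w => complex.Re (u w)) q +i*
           pd k (fun w => complex.Im (u w)) q.

Definition cpdm (R : realType) m n (k : 'I_2) (A : R * R -> 'M[R[i]]_(m, n)) :
    R * R -> 'M[R[i]]_(m, n) :=
  fun q => \matrix_(i, j) cpd k (fun w => A w i j) q.

Definition ci (R : realType) : R[i] := 0 +i* 1.

Definition dz (R : realType) (u : R * R -> R[i]) : R * R -> R[i] :=
  fun q => (cpd 0 u q - ci R * cpd 1 u q) / 2.

Definition dzb (R : realType) (u : R * R -> R[i]) : R * R -> R[i] :=
  fun q => (cpd 0 u q + ci R * cpd 1 u q) / 2.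

Definition dzm (R : realType) m n (A : R * R -> 'M[R[i]]_(m, n)) :
    R * R -> 'M[R[i]]_(m, n) :=
  fun q => \matrix_(i, j) dz (fun w => A w i j) q.

Definition dzbm (R : realType) m n (A : R * R -> 'M[R[i]]_(m, n)) :
    R * R -> 'M[R[i]]_(m, n) :=
  fun q => \matrix_(i, j) dzb (fun w => A w i j) q.

Definition cplx (R : realType) m n (A : 'M[R]_(m, n)) : 'M[R[i]]_(m, n) :=
  map_mx (fun x : R => x%:C) A.

(* [H s t] contracts the loop [c] to its base point, relative to that point;
   [s] is the deformation parameter. *)
Definition simply_connected (R : realType) (D : set (R * R)) : Prop :=
  forall c : R -> R * R,
    {within `[0, 1]%classic, continuous c} ->
    (forall t, t \in `[0, 1] -> D (c t)) -> c 0 = c 1 ->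
    exists H : R * R -> R * R,
      [/\ {within `[0, 1]%classic `*` `[0, 1]%classic, continuous H},
          forall s t, s \in `[0, 1] -> t \in `[0, 1] -> D (H (s, t)),
          forall t, t \in `[0, 1] -> H (0, t) = c t /\ H (1, t) = c 0 &
          forall s, s \in `[0, 1] -> H (s, 0) = c 0 /\ H (s, 1) = c 0].

Definition sc_domain (R : realType) (D : set (R * R)) : Prop :=
  [/\ open D, D !=set0, connected D & simply_connected D].

(* A map into RP^3 assigns to each point a line of R^4. *)
Definition local_lift (R : realType) (W : set (R * R))
    (S : R * R -> {vspace 'rV[R]_4}) (f : R * R -> 'rV[R]_4) : Prop :=
  smoothm W f /\ forall w, W w -> f w != 0 /\ S w = <[f w]>%VS.

Definition immersed_surface (R : realType) (D : set (R * R))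
    (S : R * R -> {vspace 'rV[R]_4}) : Prop :=
  forall q, D q -> exists (W : set (R * R)) (f : R * R -> 'rV[R]_4),
    [/\ open W, W q, W `<=` D, local_lift W S f &
        forall w, W w -> free [:: f w; pdm 0 f w; pdm 1 f w]].

(* Gauss formula D_X f_* Y = f_* (nabla_X Y) + h(X,Y) xi + T(X,Y) zeta in the
   coordinate frame: G i j k are the Christoffel symbols of nabla, and the
   radial field zeta along f is f itself. *)
Definition gauss_formula (R : realType) (D : set (R * R))
    (f xi : R * R -> 'rV[R]_4) (G : R * R -> 'I_2 -> 'I_2 -> 'I_2 -> R)
    (h T : R * R -> 'M[R]_2) : Prop :=
  forall q i j, D q ->
    pdm i (pdm j f) q =
      \sum_(k < 2) G q i j k *: pdm k f q + h q i j *: xi q + T q i j *: f q.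

(* The last clause says that h is positive definite and that z is a complex
   coordinate for [h], i.e. h = lambda (dx^2 + dy^2) with lambda > 0. *)
Definition definite_surface (R : realType) (D : set (R * R))
    (f : R * R -> 'rV[R]_4) : Prop :=
  exists (xi : R * R -> 'rV[R]_4) (G : R * R -> 'I_2 -> 'I_2 -> 'I_2 -> R)
         (h T : R * R -> 'M[R]_2),
    [/\ smoothm D xi,
        forall q, D q -> free [:: f q; pdm 0 f q; pdm 1 f q; xi q],
        gauss_formula D f xi G h T &
        forall q, D q -> exists2 lambda, 0 < lambda & h q = lambda%:M].

Definition canonical_system (R : realType) (D : set (R * R))
    (f : R * R -> 'rV[R]_4) (b p : R * R -> R[i]) : Prop :=
  let fc := fun w => cplx (f w) in
  forall q, D q ->
    dzm (dzm fc) q = b q *: dzbm fc q + p q *: fc q /\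
    dzbm (dzbm fc) q = conjc (b q) *: dzm fc q + conjc (p q) *: fc q.

Section Invariants.
Context (R : realType) (b p : R * R -> R[i]).

Let bb : R * R -> R[i] := fun w => conjc (b w).

(* (log b)_{z zbar} is computed from the logarithmic derivative
   (log b)_z = b_z / b, which does not depend on the branch of log. *)
Definition inv_k : R * R -> R[i] :=
  fun q => (`|b q| ^+ 2 - dzb (fun w => dz b w / b w) q) / 2.

Definition inv_P : R * R -> R[i] :=
  fun q => p q + dzb b q / 2 - dz (dz bb) q / (2 * bb q)
           + dz bb q ^+ 2 / (4 * bb q ^+ 2).

Definition mx4 (s : seq (seq R[i])) : 'M[R[i]]_4 :=
  \matrix_(i, j) nth 0 (nth [::] s i) j.

Definition mxU : R * R -> 'M[R[i]]_4 := fun q =>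
  let a := dz bb q / (2 * bb q) in let k := inv_k q in let P := inv_P q in
  mx4 [:: [:: a;   P; k;   b q * conjc P];
          [:: 1; - a; 0;   k];
          [:: 0; b q; a;   P];
          [:: 0;   0; 1; - a]].

Definition mxV : R * R -> 'M[R[i]]_4 := fun q =>
  let a := dzb b q / (2 * b q) in let k := inv_k q in let P := inv_P q in
  mx4 [:: [:: a; conjc k; conjc P; bb q * P];
          [:: 0; a;  bb q; conjc P];
          [:: 1; 0;   - a; conjc k];
          [:: 0; 1;     0; - a]].

End Invariants.

(* S is the surface, f its canonical lift with coefficients b and p; the
   projective metric 8 |b|^2 dz dzbar is positive definite as b <> 0. *)
Record definite_demoulin (R : realType) (D : set (R * R))
    (S : R * R -> {vspace 'rV[R]_4}) (f : R * R -> 'rV[R]_4)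
    (b p : R * R -> R[i]) : Prop := DefiniteDemoulin {
  dd_immersed : immersed_surface D S;
  dd_lift : local_lift D S f;
  dd_definite : definite_surface D f;
  dd_smooth_b : smoothc D b;
  dd_smooth_p : smoothc D p;
  dd_canonical : canonical_system D f b p;
  dd_metric : forall q, D q -> b q != 0;
  dd_demoulin : forall q, D q -> inv_P b p q = 0
}.

Definition wilczynski_frame (R : realType) (D : set (R * R))
    (b p : R * R -> R[i]) (zs : R * R) (F : R * R -> 'M[R[i]]_4) : Prop :=
  [/\ smoothcm D F, F zs = 1%:M &
      forall q, D q -> dzm F q = F q *m mxU b p q /\
                       dzbm F q = F q *m mxV b p q].

Definition mxL (R : realType) : 'M[R[i]]_4 :=
  let s := (Num.sqrt 2)%:C in
  s^-1 *: mx4 [:: [:: s;  0;    0; 0];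
                  [:: 0; ci R; - ci R; 0];
                  [:: 0;  1;    1; 0];
                  [:: 0;  0;    0; s]].

Definition mxJ1 (R : realType) : 'M[R[i]]_4 :=
  mx4 [:: [:: 0; 0; 0; 1];
          [:: 0; 0; 1; 0];
          [:: 0; 1; 0; 0];
          [:: 1; 0; 0; 0]].

Definition grpG (R : realType) : set 'M[R[i]]_4 :=
  [set a | exists2 A : 'M[R]_4, \det A = 1 & a = invmx (mxL R) *m cplx A *m mxL R].

Definition grpK1 (R : realType) : set 'M[R[i]]_4 :=
  [set a | grpG a /\ a *m mxJ1 R *m a^T = mxJ1 R].

(* Elements of Q are regarded as complex matrices with real entries. *)
Definition quadrics (R : realType) : set 'M[R[i]]_4 :=
  [set Q | exists A : 'M[R]_4,
     [/\ Q = cplx A, A^T = A, \det A = -1 &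
         exists l1 l2 l3 l4 : R,
           [/\ 0 < l1, 0 < l2, 0 < l3, l4 < 0 &
               char_poly A = \prod_(l <- [:: l1; l2; l3; l4]) ('X - l%:P)]]].

Definition qmetric (R : realType) (Q X Y : 'M[R[i]]_4) : R[i] :=
  \tr (invmx Q *m X *m invmx Q *m Y).

Definition hatJ1 (R : realType) : 'M[R[i]]_4 := mxL R *m mxJ1 R *m (mxL R)^T.

Definition gauss1 (R : realType) (F : R * R -> 'M[R[i]]_4) : R * R -> 'M[R[i]]_4 :=
  fun q => let Fh := mxL R *m F q *m invmx (mxL R) in Fh *m hatJ1 R *m Fh^T.

Definition conformal_map (R : realType) (D : set (R * R))
    (g : R * R -> 'M[R[i]]_4) : Prop :=
  forall q, D q -> qmetric (g q) (dzm g q) (dzm g q) = 0.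

(* The Levi-Civita connection of [qmetric] is
   nabla_X Y = D_X Y - (X Q^-1 Y + Y Q^-1 X) / 2: it is torsion free, and for
   constant X, Y the derivative of <X, Y>_Q along Z is
   - Tr(Q^-1 Z Q^-1 X Q^-1 Y) - Tr(Q^-1 X Q^-1 Z Q^-1 Y).  The hypersurface Q is
   totally geodesic in the space of invertible symmetric matrices, so the same
   formula holds on it. *)
Definition christoffel (R : realType) (Q X Y : 'M[R[i]]_4) : 'M[R[i]]_4 :=
  - 2^-1 *: (X *m invmx Q *m Y + Y *m invmx Q *m X).

(* Trace of the second fundamental form of g for the flat metric dx^2 + dy^2;
   another metric of the conformal class only rescales it. *)
Definition tension (R : realType) (g : R * R -> 'M[R[i]]_4) : R * R -> 'M[R[i]]_4 :=
  fun q => \sum_(i < 2)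
    (cpdm i (cpdm i g) q + christoffel (g q) (cpdm i g q) (cpdm i g q)).

Definition harmonic_map (R : realType) (D : set (R * R))
    (g : R * R -> 'M[R[i]]_4) : Prop :=
  smoothcm D g /\ forall q, D q -> tension g q = 0.

Definition epsilon (R : realType) : R[i] :=
  cos (2 * pi / 3) +i* sin (2 * pi / 3).

Definition omega (R : realType) : R[i] := - epsilon R.

Definition mxE (R : realType) : 'M[R[i]]_4 :=
  mx4 [:: [:: 1; 0; 0; 0];
          [:: 0; epsilon R ^+ 2; 0; 0];
          [:: 0; 0; epsilon R; 0];
          [:: 0; 0; 0; 1]].

Definition tau1 (R : realType) (a : 'M[R[i]]_4) : 'M[R[i]]_4 :=
  mxJ1 R *m invmx a^T *m mxJ1 R.

Definition sigma (R : realType) (a : 'M[R[i]]_4) : 'M[R[i]]_4 :=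
  mxE R *m a *m invmx (mxE R).

Definition kappa (R : realType) (a : 'M[R[i]]_4) : 'M[R[i]]_4 := tau1 (sigma a).

(* The differential of kappa at the identity: sigma is linear, and the
   differential of a |-> (a^T)^-1 is X |-> - X^T. *)
Definition dkappa (R : realType) (X : 'M[R[i]]_4) : 'M[R[i]]_4 :=
  - (mxJ1 R *m (sigma X)^T *m mxJ1 R).

Definition grpK (R : realType) : set 'M[R[i]]_4 :=
  [set a | exists (k1 : R) (k2 : R[i]),
     [/\ k1 != 0, `|k2| = 1 &
         a = mx4 [:: [:: k1%:C; 0; 0; 0];
                     [:: 0; k2; 0; 0];
                     [:: 0; 0; k2^-1; 0];
                     [:: 0; 0; 0; k1%:C^-1]]]].

Definition lieG (R : realType) : set 'M[R[i]]_4 :=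
  [set X | exists2 A : 'M[R]_4, \tr A = 0 & X = invmx (mxL R) *m cplx A *m mxL R].

Definition lieK (R : realType) : set 'M[R[i]]_4 :=
  [set X | lieG X /\ dkappa X = X].

Definition gC (R : realType) (j : 'Z_6) : set 'M[R[i]]_4 :=
  [set X | \tr X = 0 /\ dkappa X = omega R ^+ j *: X].

Definition bracket (R : realType) (X Y : 'M[R[i]]_4) : 'M[R[i]]_4 :=
  X *m Y - Y *m X.

(* Trace of ad X \o ad Y on M_4(C); as its image consists of trace-free
   matrices, this is also its trace on sl_4(C), hence on any real form. *)
Definition killing (R : realType) (X Y : 'M[R[i]]_4) : R[i] :=
  \tr (lin_mx (fun Z : 'M[R[i]]_4 => bracket X (bracket Y Z))).

Definition nondegenerate_on (R : realType) (V : set 'M[R[i]]_4)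
    (B : 'M[R[i]]_4 -> 'M[R[i]]_4 -> R[i]) : Prop :=
  forall X, V X -> (forall Y, V Y -> B X Y = 0) -> X = 0.

Definition real_subspace (R : realType) (V : set 'M[R[i]]_4) : Prop :=
  V 0 /\ forall (a : R) X Y, V X -> V Y -> V (a%:C *: X + Y).

Definition fixed_in (R : realType) (G : set 'M[R[i]]_4)
    (tau : 'M[R[i]]_4 -> 'M[R[i]]_4) : set 'M[R[i]]_4 :=
  [set a | G a /\ tau a = a].

(* Path component of the identity; for a Lie group this is the identity
   component. *)
Definition identity_component (R : realType) (H : set 'M[R[i]]_4) :
    set 'M[R[i]]_4 :=
  [set a | exists c : R -> 'M[R[i]]_4,
     [/\ forall i j,
           {within `[0, 1]%classic, continuous (fun t => complex.Re (c t i j))} /\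
           {within `[0, 1]%classic, continuous (fun t => complex.Im (c t i j))},
         forall t, t \in `[0, 1] -> H (c t), c 0 = 1%:M & c 1 = a]].

Definition order_on (R : realType) (G : set 'M[R[i]]_4)
    (tau : 'M[R[i]]_4 -> 'M[R[i]]_4) (m : nat) : Prop :=
  [/\ (0 < m)%N, forall a, G a -> iter m tau a = a &
      forall j, (0 < j < m)%N -> exists2 a, G a & iter j tau a <> a].

(* For a matrix group G with Lie algebra g, an automorphism tau of G with
   differential dtau, and a subgroup K with Lie algebra k.  In [rss_reductive],
   p is the reductive complement of k, identified with the tangent space of
   G / K at the base point; non-degeneracy of the (Ad-invariant) Killing form
   on p is what makes its multiples induce G-invariant semi-Riemannian metrics. *)
Record regular_symmetric_space (R : realType) (m : nat)
    (G g K k : set 'M[R[i]]_4) (tau dtau : 'M[R[i]]_4 -> 'M[R[i]]_4) : Prop :=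
  RegularSymmetricSpace {
  rss_order_ge2 : (2 <= m)%N;
  rss_semisimple : nondegenerate_on g (@killing R);
  rss_bij : set_bij G G tau;
  rss_morph : forall a c, G a -> G c -> tau (a *m c) = tau a *m tau c;
  rss_order : order_on G tau m;
  rss_group : K 1%:M /\ forall a c, K a -> K c -> K (invmx a *m c);
  rss_sub : K `<=` fixed_in G tau;
  rss_component : identity_component (fixed_in G tau) `<=` K;
  rss_lie : k = fixed_in g dtau;
  rss_reductive : exists p : set 'M[R[i]]_4,
    [/\ real_subspace p,
        g = [set X + Y | X in k & Y in p],
        k `&` p = [set 0],
        forall a X, K a -> p X -> p (a *m X *m invmx a) &
        nondegenerate_on p (@killing R)];
  rss_regular : nondegenerate_on k (@killing R)
}.

(* The point gH of G / H is the coset itself. *)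
Definition lcoset_set (R : realType) (H : set 'M[R[i]]_4) (g : 'M[R[i]]_4) :
    set 'M[R[i]]_4 := [set g *m a | a in H].

Definition quot (R : realType) (G H : set 'M[R[i]]_4) : set (set 'M[R[i]]_4) :=
  [set lcoset_set H g | g in G].

Definition proj_coset (R : realType) (H c : set 'M[R[i]]_4) : set 'M[R[i]]_4 :=
  [set g *m a | g in c & a in H].

(* G -> G / H is a submersion, so a map into G / H is smooth iff it has smooth
   G-valued lifts near every point. *)
Definition smooth_lift (R : realType) (G H : set 'M[R[i]]_4) (W : set (R * R))
    (psi : R * R -> set 'M[R[i]]_4) (Psi : R * R -> 'M[R[i]]_4) : Prop :=
  [/\ open W, smoothcm W Psi &
      forall w, W w -> G (Psi w) /\ psi w = lcoset_set H (Psi w)].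

Definition smooth_map (R : realType) (G H : set 'M[R[i]]_4) (D : set (R * R))
    (psi : R * R -> set 'M[R[i]]_4) : Prop :=
  (forall q, D q -> quot G H (psi q)) /\
  forall q, D q -> exists W Psi,
    [/\ W q, W `<=` D & smooth_lift G H W psi Psi].

(* Fibre of the bundle [g_j] over the point c of G / K: for c = gK it is
   Ad(g) g_j, independently of the representative g. *)
Definition bundle (R : realType) (j : 'Z_6) (c : set 'M[R[i]]_4) :
    set 'M[R[i]]_4 :=
  [set g *m Y *m invmx g | g in c & Y in gC j].

(* X in g^C represents d psi (d/dz) at q under the infinitesimal action of g^C
   on G / K, which identifies the complexified tangent space at psi q with
   g^C modulo the isotropy algebra [g_0]_(psi q). If psi = Psi K, then
   d psi (d/dz) is represented by (d Psi / dz) Psi^-1. *)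
Definition represents_dpsi_dz (R : realType) (D : set (R * R))
    (psi : R * R -> set 'M[R[i]]_4) (q : R * R) (X : 'M[R[i]]_4) : Prop :=
  exists W Psi, [/\ W q, W `<=` D, smooth_lift (@grpG R) (@grpK R) W psi Psi &
    bundle 0 (psi q) (X - dzm Psi q *m invmx (Psi q))].

Definition primitive_map (R : realType) (D : set (R * R))
    (psi : R * R -> set 'M[R[i]]_4) : Prop :=
  smooth_map (@grpG R) (@grpK R) D psi /\
  forall q, D q ->
    exists2 X, bundle (-1) (psi q) X & represents_dpsi_dz D psi q X.

(* The identification G / K1 -> Q, gK1 |-> L g J1 g^T L^T, with values given as
   singletons. *)
Definition toQ (R : realType) (c : set 'M[R[i]]_4) : set 'M[R[i]]_4 :=
  [set mxL R *m g *m mxJ1 R *m g^T *m (mxL R)^T | g in c].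

(* Main.v *)
From mathcomp Require Import all_boot all_order all_algebra.
From mathcomp Require Import all_classical all_reals all_analysis.
From mathcomp Require Import complex ring lra.
Require Import Defs.

(**
A solution F of F_z = F U, F_zb = F V has constant determinant since U and V
are trace-free, and the reality condition singling out G is preserved because
the conjugate of U by the exchange of the two middle indices is V; hence F is
G-valued.  When P = 0, U splits as N + X with N diagonal, in the eigenspace
g_0, and X in g_(-1), so q |-> F(q) K is primitive.  As K lies in K1, this map
projects to the Gauss map L F J1 F^T L^T.  Up to conjugation by L F, the
z-derivative of the Gauss map is 2 X J1: conformality is Tr(X^2) = 0, and
harmonicity is X_zb + [V_k, X] = 0, whose only equation not contained in the
definition of U and V is k_zb = - (b_zb / b) k, an entry of the integrability
condition of the system.
*)

Set Implicit Arguments.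
Unset Strict Implicit.
Unset Printing Implicit Defensive.
Import Order.TTheory GRing.Theory Num.Theory.
Import numFieldNormedType.Exports.
Local Open Scope classical_set_scope.
Local Open Scope ring_scope.
Local Open Scope complex_scope.

(** Regularity and integrability are both read off from the frame. Since [F] is smooth with
    determinant 1, the coefficient matrices [F^-1 F_z] and [F^-1 F_zb] are smooth, and with them
    their entries; integrability is then the equality of mixed derivatives of [F]. The inverse of
    [F] is written as its adjugate, whose entries are polynomials in those of [F], so no quotient
    rule is needed. The tension field is defined in the real coordinates and the frame equations in
    the complex ones; the link is [F^-1 F_x = U + V] and [F^-1 F_y = i (U - V)]. The derivatives
    [a_zb] and [conj(a)_z] of the diagonal entries also occur in the tension, but they sit in a
    diagonal matrix that is odd under reflection in the antidiagonal and cancel there, so no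
    equation for them is required. That the Gauss map takes values in the quadrics is a separate
    matter of signature: the spectral theorem gives real eigenvalues, and at most one of them can be
    nonpositive because [hatJ1] is the identity minus a rank-one square. *)

Local Notation o0 := (@Ordinal 4 0 isT).
Local Notation o1 := (@Ordinal 4 1 isT).
Local Notation o2 := (@Ordinal 4 2 isT).
Local Notation o3 := (@Ordinal 4 3 isT).

(** * Real functions on the plane: constancy and symmetry of second derivatives *)

Section RealSmooth.
Context (R : realType).
Implicit Types (D : set (R * R)) (u v : R * R -> R) (q : R * R) (i : 'I_2).

Lemma near_pd i u v q : (\near q, u q = v q) -> pd i u q = pd i v q.
Proof.
exact: near_eq_derive.
Qed.

(** The first-order expansion of [u] at [q] is also one of [v], and a continuous linear map with
    such an expansion is the differential. *)
Lemma near_differentiable u v q :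
  (\near q, u q = v q) -> differentiable u q -> differentiable v q.
Proof.
move=> uv; have uvq : u q = v q by apply: nbhs_singleton uv.
move=> /diff_locallyP[du ou].
have ov : v \o shift q = cst (v q) + 'd u q +o_ (0 : R * R) id.
  apply/eqaddoP => e e0; have := ou; rewrite -uvq => /eqaddoP /(_ e e0).
  apply: filter_app.
  have : \forall h \near (0 : R * R), u (h + q) = v (h + q).
    have := uv; rewrite (@near_shift _ _ 0 q) subr0.
    by apply: filterS.
  by apply: filterS => h h1 h2; rewrite !fctE /= in h2 *; rewrite -h1.
by apply/diff_locallyP; rewrite (diff_unique du ov).
Qed.

Lemma open_near D u v q : open D -> D q -> {in D, u =1 v} -> \near q, u q = v q.
Proof.
move=> oD Dq uv; have : nbhs q D by exact: open_nbhs_nbhs.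
by apply: filterS => w Dw; apply: uv; rewrite inE.
Qed.

(** The rules for derivatives hold only at points of [D], so the closure properties of [Cn] replace
    a derivative by a function equal to it on [D] alone; openness makes the equality local. *)
Lemma eq_Cn D n : open D -> forall u v, {in D, u =1 v} -> Cn n D u -> Cn n D v.
Proof.
move=> oD; elim: n => [|n IH] u v uv /=.
  move=> cu q Dq; have := cu q Dq.
  rewrite /continuous_at => h.
  have uvq := open_near oD Dq uv.
  have e : u q = v q by apply: uv; rewrite inE.
  move=> B; rewrite /= -e => uB; move: B uB; apply: cvg_trans h; apply: near_eq_cvg.
  by apply: filterS uvq => w ->.
move=> [du cu]; split.
  by move=> q Dq; apply: near_differentiable (du q Dq); exact: open_near uv.
move=> i; apply: IH (cu i) => q; rewrite inE => Dq.
by apply: near_pd; exact: open_near uv.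
Qed.

Lemma CnW D n u : Cn n.+1 D u -> Cn n D u.
Proof.
elim: n u => [|n IH] u.
  by move=> [du _] q Dq; exact: differentiable_continuous (du q Dq).
by move=> [du cu]; split=> // i; apply: IH; exact: cu.
Qed.

Lemma pd_cst i (c : R) q : pd i (fun=> c) q = 0.
Proof. exact: derive_cst. Qed.

Lemma Cn_cst D n (c : R) : Cn n D (fun=> c).
Proof.
elim: n c => [|n IH] c /=; first by move=> q _; exact: cst_continuous.
split=> [q _|i]; first exact: differentiable_cst.
have -> : pd i (fun=> c) = fun=> 0 by apply/funext => q; exact: pd_cst.
exact: IH.
Qed.

Lemma pdD i u v q : differentiable u q -> differentiable v q ->
  pd i (fun w => u w + v w) q = pd i u q + pd i v q.
Proof. by move=> du dv; apply: deriveD; exact: diff_derivable. Qed.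

Lemma pdN i u q : differentiable u q -> pd i (fun w => - u w) q = - pd i u q.
Proof. by move=> du; apply: deriveN; exact: diff_derivable. Qed.

Lemma pdM i u v q : differentiable u q -> differentiable v q ->
  pd i (fun w => u w * v w) q = pd i u q * v q + u q * pd i v q.
Proof.
move=> du dv; rewrite /pd [LHS]deriveM; [|exact: diff_derivable..].
by rewrite addrC mulrC.
Qed.

Lemma CnD D n u v : open D -> Cn n D u -> Cn n D v -> Cn n D (fun w => u w + v w).
Proof.
move=> oD; elim: n u v => [|n IH] u v /=.
  by move=> cu cv q Dq; apply: cvgD; [exact: cu|exact: cv].
move=> [du cu] [dv cv]; split=> [q Dq|i]; first exact: differentiableD (du q Dq) (dv q Dq).
apply: (@eq_Cn _ _ oD (fun w => pd i u w + pd i v w)); last exact: IH.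
by move=> q; rewrite inE => Dq; rewrite pdD//; [exact: du|exact: dv].
Qed.

Lemma CnN D n u : open D -> Cn n D u -> Cn n D (fun w => - u w).
Proof.
move=> oD; elim: n u => [|n IH] u /=.
  by move=> cu q Dq; apply: cvgN; exact: cu.
move=> [du cu]; split=> [q Dq|i]; first exact: differentiableN (du q Dq).
apply: (@eq_Cn _ _ oD (fun w => - pd i u w)); last exact: IH.
by move=> q; rewrite inE => Dq; rewrite pdN//; exact: du.
Qed.

Lemma CnM D n u v : open D -> Cn n D u -> Cn n D v -> Cn n D (fun w => u w * v w).
Proof.
move=> oD; elim: n u v => [|n IH] u v.
  by move=> cu cv q Dq; apply: cvgM; [exact: cu|exact: cv].
move=> cun cvn; have [du cu] := cun; have [dv cv] := cvn.
split=> [q Dq|i]; first exact: differentiableM (du q Dq) (dv q Dq).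
apply: (@eq_Cn _ _ oD (fun w => pd i u w * v w + u w * pd i v w)).
  by move=> q; rewrite inE => Dq; rewrite pdM//; [exact: du|exact: dv].
apply: CnD => //; apply: IH; first [exact: cu|exact: cv|exact: CnW cun|exact: CnW cvn].
Qed.

Lemma smooth_pd D i u : smooth D u -> smooth D (pd i u).
Proof. by move=> su n; have [_ +] := su n.+1; apply. Qed.

Lemma smooth_diff D u q : smooth D u -> D q -> differentiable u q.
Proof. by move=> /(_ 1%N)[du _]; exact: du. Qed.

Lemma smooth_cont D u q : smooth D u -> D q -> {for q, continuous u}.
Proof. by move=> /(_ 0%N); apply. Qed.

(** Restriction to a line turns a directional derivative into an ordinary one, to which the
    one-variable mean value theorem applies. *)
Lemma is_derive_line u (q v : R * R) (t : R) : differentiable u (q + t *: v) ->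
  is_derive t (1:R) (fun s : R => u (q + s *: v)) ('D_v u (q + t *: v)).
Proof.
move=> /diff_derivable => /(_ v) du.
have E (h : R) : h^-1 *: (u (q + (h *: (1:R) + t) *: v) - u (q + t *: v)) =
   h^-1 *: (u (h *: v + (q + t *: v)) - u (q + t *: v)).
  by congr (_ *: (u _ - _)); rewrite -[h%:A]/(h * 1) mulr1 scalerDl addrCA.
split; first by rewrite /derivable; under eq_fun do rewrite E.
by rewrite /derive; under eq_fun do rewrite E.
Qed.

Lemma line_MVT u (q v : R * R) (h : R) : 0 < h ->
  (forall t, 0 <= t <= h -> differentiable u (q + t *: v)) ->
  exists2 c, 0 < c < h & u (q + h *: v) - u q = 'D_v u (q + c *: v) * h.
Proof.
move=> h0 du.
have dl (t : R) (t0h : 0 <= t <= h) := is_derive_line (du t t0h).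
have [t||c c0h] := @MVT R (fun s : R => u (q + s *: v)) (fun s => 'D_v u (q + s *: v)) 0 h h0.
- by rewrite in_itv /= => /andP[/ltW t0 /ltW th]; apply: dl; rewrite t0.
- apply: derivable_within_continuous => t; rewrite in_itv /= => tt.
  by have [] := dl t tt.
- by rewrite scale0r addr0 subr0 => e; exists c.
Qed.

Lemma derive_translate u (q v a : R * R) :
  'D_v (fun w => u (w + a)) q = 'D_v u (q + a).
Proof.
have E : (fun h => h^-1 *: (((fun w => u (w + a)) \o shift q) (h *: v) - u (q + a))) =
    (fun h => h^-1 *: ((u \o shift (q + a)) (h *: v) - u (q + a))).
  by apply/funext => h /=; rewrite addrA.
by rewrite /derive E.
Qed.

Lemma differentiable_translate u (q a : R * R) :
  differentiable u (q + a) -> differentiable (fun w => u (w + a)) q.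
Proof.
move=> du; have -> : (fun w => u (w + a)) = u \o shift a by [].
by apply: differentiable_comp => //; exact: differentiableD.
Qed.

Lemma derive_dir u q (v : R * R) : differentiable u q ->
  'D_v u q = v.1 * pd 0 u q + v.2 * pd 1 u q.
Proof.
move=> du; rewrite /pd !deriveE//.
have -> : v = v.1 *: dir R 0 + v.2 *: dir R 1.
  by case: v => a c; congr pair; rewrite /= /GRing.scale /= ?mulr1 ?mulr0 ?addr0 ?add0r.
by rewrite linearD !linearZ /= /GRing.scale /= !mulr1 !mulr0 addr0 add0r.
Qed.

Lemma ball_segment q w (r t : R) : ball q r w -> 0 <= t <= 1 ->
  ball q r (q + t *: (w - q)).
Proof.
move=> [b1 b2] /andP[t0 t1].
have H (a c : R) : ball a r c -> ball a r (a + t * (c - a)).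
  rewrite /ball /= => h; rewrite opprD addrA subrr sub0r normrN normrM ger0_norm//.
  rewrite distrC; apply: le_lt_trans h; rewrite -[leRHS]mul1r.
  exact: ler_wpM2r.
by split; apply: H.
Qed.

(** The mean value theorem along segments makes [u] constant on small balls, so the set where [u]
    takes the value [u q0] is open and closed in [D]. *)
Lemma const_of_pd0 D u q0 : open D -> connected D -> D q0 ->
  (forall w, D w -> differentiable u w) ->
  (forall i w, D w -> pd i u w = 0) -> forall w, D w -> u w = u q0.
Proof.
move=> oD cD Dq0 du pu0.
have loc q : D q -> \forall w \near q, D w /\ u w = u q.
  move=> Dq; have /nbhs_ballP[r r0 br] : nbhs q D by exact: open_nbhs_nbhs.
  apply/nbhs_ballP; exists r => //= w bw; split; first exact: br.
  have seg t : 0 <= t <= 1 -> D (q + t *: (w - q)).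
    by move=> t01; apply: br; exact: ball_segment.
  have [|c c01] := @line_MVT u q (w - q) 1 ltr01.
    by move=> t t01; exact/du/seg.
  have Dc : D (q + c *: (w - q)).
    by apply: seg; case/andP: c01 => /ltW -> /ltW ->.
  rewrite derive_dir; last exact: du.
  rewrite !pu0// !mulr0 addr0 mul0r scale1r addrCA subrr addr0 => /eqP.
  by rewrite subr_eq0 => /eqP.
pose B := [set w | D w /\ u w = u q0].
have oB : open B.
  rewrite openE => w [Dw e]; apply: filterS (loc w Dw) => w' [? ?].
  by split=> //; congruence.
have oC : open [set w | D w /\ u w <> u q0].
  rewrite openE => w [Dw e]; apply: filterS (loc w Dw) => w' [? ?].
  by split=> //; congruence.
have BD : B = D.
  apply: cD.
  - by exists q0.
  - by exists B => //; rewrite setIidr// => w [].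
  (* Relative closedness: [B] is the trace on [D] of the complement of the open set where [u] takes
     another value. *)
  - exists (~` [set w | D w /\ u w <> u q0]); first exact: open_closedC.
    apply/seteqP; split=> w /=.
      by move=> [Dw e]; split=> // -[].
    move=> [Dw ne]; split=> //; apply: contrapT => ?; exact: ne.
by move=> w Dw; move: (Dw); rewrite -BD => -[].
Qed.

(* The left-hand side is symmetric in [i] and [j], so this compares the two
   mixed derivatives. *)
Lemma double_difference D u q i j (h : R) : smooth D u -> 0 < h ->
  (forall s t : R, 0 <= s <= h -> 0 <= t <= h -> D (q + s *: dir R i + t *: dir R j)) ->
  exists s t : R, [/\ 0 < s < h, 0 < t < h &
    u (q + h *: dir R i + h *: dir R j) - u (q + h *: dir R i)
      - u (q + h *: dir R j) + u q =
    pd j (pd i u) (q + s *: dir R i + t *: dir R j) * h * h].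
Proof.
move=> su h0 Dst.
pose g w := u (w + h *: dir R j) - u w.
have hh : 0 <= h <= h by rewrite lexx ltW.
have h00 : 0 <= (0:R) <= h by rewrite lexx ltW.
have D0 s : 0 <= s <= h -> D (q + s *: dir R i).
  by move=> hs; have := Dst s 0 hs h00; rewrite scale0r addr0.
have Dh s : 0 <= s <= h -> D (q + s *: dir R i + h *: dir R j).
  by move=> hs; exact: Dst.
have dg s : 0 <= s <= h ->
    differentiable (fun w => u (w + h *: dir R j)) (q + s *: dir R i).
  by move=> hs; apply: differentiable_translate; exact: (smooth_diff su) (Dh s hs).
(* The double difference is an increment of [g] in direction [i]; once this is a derivative, a
   second mean value in direction [j] is applied to [pd i u]. *)
have [s s0h es] : exists2 s, 0 < s < h &
    g (q + h *: dir R i) - g q = 'D_(dir R i) g (q + s *: dir R i) * h.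
  apply: (@line_MVT g q (dir R i) h h0) => s hs.
  by apply: differentiableB (dg s hs) _; exact: (smooth_diff su) (D0 s hs).
have hs : 0 <= s <= h by case/andP: s0h => /ltW -> /ltW ->.
have [t t0h et] := @line_MVT (pd i u) (q + s *: dir R i) (dir R j) h h0
  (fun t ht => smooth_diff (smooth_pd i su) (Dst s t hs ht)).
exists s, t; split=> //.
have -> : pd j (pd i u) (q + s *: dir R i + t *: dir R j) * h =
  pd i u (q + s *: dir R i + h *: dir R j) - pd i u (q + s *: dir R i) by rewrite et.
have -> : pd i u (q + s *: dir R i + h *: dir R j) - pd i u (q + s *: dir R i) =
   'D_(dir R i) g (q + s *: dir R i).
  rewrite /g [RHS]deriveB.
  - by rewrite derive_translate.
  - exact/diff_derivable/dg.
  - exact/diff_derivable/(smooth_diff su)/D0.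
rewrite -es /g; ring.
Qed.

(** Two steps of at most [r / 3] move each coordinate by at most [2 r / 3], even when [i = j], so
    the bound by [r] stays strict. *)
Lemma ball_dir q i j (r s t : R) : 0 < r -> 0 <= s <= r / 3 -> 0 <= t <= r / 3 ->
  ball q r (q + s *: dir R i + t *: dir R j).
Proof.
move=> r0 /andP[s0 sr] /andP[t0 tr].
have H (a d d' : R) : 0 <= d <= 1 -> 0 <= d' <= 1 -> ball a r (a + s * d + t * d').
  move=> /andP[d0 d1] /andP[d'0 d'1]; rewrite /ball /=.
  have -> : a - (a + s * d + t * d') = - (s * d + t * d') by ring.
  rewrite normrN ger0_norm ?addr_ge0 ?mulr_ge0//.
  have sd : s * d <= s by rewrite ler_piMr.
  have td : t * d' <= t by rewrite ler_piMr.
  lra.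
by split; apply: H; rewrite /dir; case: ifP => _; rewrite /= ?lexx ?ler01.
Qed.

Lemma dist_le_half (x y z e : R) :
  `|x - z| < e / 2 -> `|y - z| < e / 2 -> `|x - y| <= e.
Proof.
rewrite (distrC y) => xz zy; have -> : x - y = (x - z) + (z - y) by ring.
apply: le_trans (ler_normD _ _) _; lra.
Qed.

(** The same double difference over a small square is a value of either mixed derivative times the
    area. The two points differ, but continuity brings both values within [e / 2] of those at
    [q]. *)
Lemma smooth_pdC D u q i j : open D -> smooth D u -> D q ->
  pd i (pd j u) q = pd j (pd i u) q.
Proof.
move=> oD su Dq; apply/eqP; rewrite -subr_eq0 -normr_le0.
apply/ler_addgt0Pr => e e0; rewrite add0r.
have c1 := smooth_cont (smooth_pd i (smooth_pd j su)) Dq.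
have c2 := smooth_cont (smooth_pd j (smooth_pd i su)) Dq.
have e2 : 0 < e / 2 by rewrite divr_gt0.
have n1 : \forall w \near q, `|pd i (pd j u) q - pd i (pd j u) w| < e / 2.
  by move/cvgrPdist_lt: c1; apply.
have n2 : \forall w \near q, `|pd j (pd i u) q - pd j (pd i u) w| < e / 2.
  by move/cvgrPdist_lt: c2; apply.
have n3 : nbhs q D by exact: open_nbhs_nbhs.
have /nbhs_ballP[r /= r0 br] : \forall w \near q, [/\ D w,
    `|pd i (pd j u) q - pd i (pd j u) w| < e / 2 &
    `|pd j (pd i u) q - pd j (pd i u) w| < e / 2].
  by apply: filterS3 n3 n1 n2 => w; split.
have h0 : 0 < r / 3 by rewrite divr_gt0.
have [|s [t [/andP[s0 sh] /andP[t0 th] E1]]] := @double_difference D u q i j (r / 3) su h0.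
  by move=> s t hs ht; have [] := br _ (ball_dir q i j r0 hs ht).
have [|s' [t' [/andP[s'0 s'h] /andP[t'0 t'h] E2]]] := @double_difference D u q j i (r / 3) su h0.
  by move=> s' t' hs ht; have [] := br _ (ball_dir q j i r0 hs ht).
have B1 : ball q r (q + s *: dir R i + t *: dir R j).
  by apply: ball_dir => //; apply/andP; split; exact: ltW.
have B2 : ball q r (q + s' *: dir R j + t' *: dir R i).
  by apply: ball_dir => //; apply/andP; split; exact: ltW.
have [_ _ b2] := br _ B1; have [_ b1 _] := br _ B2.
have E : pd j (pd i u) (q + s *: dir R i + t *: dir R j) =
         pd i (pd j u) (q + s' *: dir R j + t' *: dir R i).
  have r3 : r / 3 != 0 by rewrite gt_eqF.
  apply/(mulIf r3)/(mulIf r3)/(etrans (esym E1))/(etrans _ E2).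
  by rewrite -(addrA q (_ *: dir R j)) [_ *: dir R j + _]addrC addrA; ring.
rewrite E in b2.
exact: dist_le_half b1 b2.
Qed.

End RealSmooth.

(** * Real partial derivatives of complex-valued functions *)

Section ComplexCalculus.
Context (R : realType).
Implicit Types (D : set (R * R)) (u v : R * R -> R[i]) (q : R * R) (k : 'I_2).

Lemma smoothc_cst D (c : R[i]) : smoothc D (fun=> c).
Proof. by split=> n; exact: Cn_cst. Qed.

Lemma eq_smoothc D u v : open D -> {in D, u =1 v} -> smoothc D u -> smoothc D v.
Proof.
move=> oD uv [su1 su2]; split=> n.
  by apply: (eq_Cn oD _ (su1 n)) => w Dw; rewrite uv.
by apply: (eq_Cn oD _ (su2 n)) => w Dw; rewrite uv.
Qed.

Lemma smoothcD D u v : open D -> smoothc D u -> smoothc D v ->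
  smoothc D (fun w => u w + v w).
Proof.
move=> oD [u1 u2] [v1 v2]; split=> n.
  have -> : (fun w => complex.Re (u w + v w)) = (fun w => complex.Re (u w) + complex.Re (v w)).
    by apply/funext => w; case: (u w); case: (v w).
  exact: CnD.
have -> : (fun w => complex.Im (u w + v w)) = (fun w => complex.Im (u w) + complex.Im (v w)).
  by apply/funext => w; case: (u w); case: (v w).
exact: CnD.
Qed.

Lemma ReM (x y : R[i]) :
  complex.Re (x * y) = complex.Re x * complex.Re y + - (complex.Im x * complex.Im y).
Proof. by case: x; case: y. Qed.

Lemma ImM (x y : R[i]) :
  complex.Im (x * y) = complex.Re x * complex.Im y + complex.Im x * complex.Re y.
Proof. by case: x; case: y. Qed.

Lemma smoothcM D u v : open D -> smoothc D u -> smoothc D v ->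
  smoothc D (fun w => u w * v w).
Proof.
move=> oD [u1 u2] [v1 v2]; split=> n.
  under eq_fun do rewrite ReM.
  by apply: CnD => //; [|apply: CnN => //]; exact: CnM.
under eq_fun do rewrite ImM.
by apply: CnD => //; exact: CnM.
Qed.

Lemma smoothc_conj D u : open D -> smoothc D u -> smoothc D (fun w => conjc (u w)).
Proof.
move=> oD [u1 u2]; split=> n.
  have -> : (fun w => complex.Re (conjc (u w))) = (fun w => complex.Re (u w)).
    by apply/funext => w; case: (u w).
  exact: u1.
have -> : (fun w => complex.Im (conjc (u w))) = (fun w => - complex.Im (u w)).
  by apply/funext => w; case: (u w).
exact: CnN.
Qed.

Lemma smoothc_sum D (I : Type) (r : seq I) (P : pred I) (f : I -> R * R -> R[i]) :
  open D -> (forall i, smoothc D (f i)) -> smoothc D (fun w => \sum_(i <- r | P i) f i w).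
Proof.
move=> oD sf; elim: r => [|i r IH].
  under eq_fun do rewrite big_nil; exact: smoothc_cst.
under eq_fun do rewrite big_cons; case: (P i) => //.
by apply: smoothcD.
Qed.

Lemma smoothc_prod D (I : Type) (r : seq I) (P : pred I) (f : I -> R * R -> R[i]) :
  open D -> (forall i, smoothc D (f i)) -> smoothc D (fun w => \prod_(i <- r | P i) f i w).
Proof.
move=> oD sf; elim: r => [|i r IH].
  under eq_fun do rewrite big_nil; exact: smoothc_cst.
under eq_fun do rewrite big_cons; case: (P i) => //.
by apply: smoothcM.
Qed.

Lemma smoothc_cpd D k u : smoothc D u -> smoothc D (cpd k u).
Proof. by move=> [u1 u2]; split; exact: smooth_pd. Qed.

Lemma near_cpd k u v q : (\near q, u q = v q) -> cpd k u q = cpd k v q.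
Proof.
move=> uv; rewrite /cpd; congr (_ +i* _); apply: near_pd;
  by apply: filterS uv => w ->.
Qed.

Lemma eq_cpd D k u v q : open D -> D q -> {in D, u =1 v} -> cpd k u q = cpd k v q.
Proof.
move=> oD Dq uv; apply: near_cpd; have : nbhs q D by exact: open_nbhs_nbhs.
by apply: filterS => w Dw; apply: uv; rewrite inE.
Qed.

Lemma cpd_cst k (c : R[i]) q : cpd k (fun=> c) q = 0.
Proof. by rewrite /cpd !pd_cst. Qed.

Lemma cpdD D k u v q : smoothc D u -> smoothc D v -> D q ->
  cpd k (fun w => u w + v w) q = cpd k u q + cpd k v q.
Proof.
move=> [u1 u2] [v1 v2] Dq; rewrite /cpd.
have -> : (fun w => complex.Re (u w + v w)) = (fun w => complex.Re (u w) + complex.Re (v w)).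
  by apply/funext => w; case: (u w); case: (v w).
have -> : (fun w => complex.Im (u w + v w)) = (fun w => complex.Im (u w) + complex.Im (v w)).
  by apply/funext => w; case: (u w); case: (v w).
by rewrite !pdD //; apply: smooth_diff Dq.
Qed.

Lemma cpdM D k u v q : open D -> smoothc D u -> smoothc D v -> D q ->
  cpd k (fun w => u w * v w) q = cpd k u q * v q + u q * cpd k v q.
Proof.
move=> oD [u1 u2] [v1 v2] Dq; rewrite /cpd.
under [X in pd k X q +i* _]eq_fun do rewrite ReM.
under [X in _ +i* pd k X q]eq_fun do rewrite ImM.
have d1 := smooth_diff u1 Dq; have d2 := smooth_diff u2 Dq.
have d3 := smooth_diff v1 Dq; have d4 := smooth_diff v2 Dq.
have dM (f g : R * R -> R) : differentiable f q -> differentiable g q ->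
  differentiable (fun w => f w * g w) q by exact: differentiableM.
rewrite !pdD ?pdN ?pdM //; try exact: dM; last exact/differentiableN/dM.
case: (u q) (v q) => [a b] [c d]; apply/eqP; rewrite eq_complex /=.
by apply/andP; split; apply/eqP; ring.
Qed.

Lemma cpd_conj D k u q : smoothc D u -> D q ->
  cpd k (fun w => conjc (u w)) q = conjc (cpd k u q).
Proof.
move=> [u1 u2] Dq; rewrite /cpd /=.
have -> : (fun w => complex.Re (conjc (u w))) = (fun w => complex.Re (u w)).
  by apply/funext => w; case: (u w).
have -> : (fun w => complex.Im (conjc (u w))) = (fun w => - complex.Im (u w)).
  by apply/funext => w; case: (u w).
by rewrite pdN //; exact: smooth_diff Dq.
Qed.

Lemma cpd_sum D k (I : Type) (r : seq I) (P : pred I) (f : I -> R * R -> R[i]) q :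
  open D -> (forall i, smoothc D (f i)) -> D q ->
  cpd k (fun w => \sum_(i <- r | P i) f i w) q = \sum_(i <- r | P i) cpd k (f i) q.
Proof.
move=> oD sf Dq; elim: r => [|i r IH].
  by rewrite big_nil; under eq_fun do rewrite big_nil; exact: cpd_cst.
rewrite big_cons; under eq_fun do rewrite big_cons; case: (P i) => //.
by rewrite (cpdD k (sf i) _ Dq) ?IH//; exact: smoothc_sum.
Qed.

(** Leibniz rule with the differentiated factor selected inside the product: this is the shape of a
    determinant term with one row replaced. *)
Lemma cpd_prod D k n (f : 'I_n -> R * R -> R[i]) q :
  open D -> (forall i, smoothc D (f i)) -> D q ->
  cpd k (fun w => \prod_(i < n) f i w) q =
  \sum_(i < n) \prod_(j < n) (if j == i then cpd k (f j) q else f j q).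
Proof.
move=> oD sf Dq; elim: n f sf => [|n IH] f sf.
  by rewrite big_ord0; under eq_fun do rewrite big_ord0; exact: cpd_cst.
under eq_fun do rewrite big_ord_recl.
rewrite (cpdM k oD (sf _) _ Dq); last exact: smoothc_prod.
rewrite IH// big_ord_recl; congr (_ + _).
  by rewrite big_ord_recl eqxx; congr (_ * _); apply: eq_bigr.
rewrite mulr_sumr; apply: eq_bigr => i _.
by rewrite big_ord_recl /=; congr (_ * _).
Qed.

Lemma cpdC D j k u q : open D -> smoothc D u -> D q ->
  cpd j (cpd k u) q = cpd k (cpd j u) q.
Proof.
move=> oD [u1 u2] Dq; by rewrite /cpd /= (smooth_pdC j k oD u1 Dq) (smooth_pdC j k oD u2 Dq).
Qed.

Lemma constc_of_cpd0 D u q0 : open D -> connected D -> D q0 -> smoothc D u ->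
  (forall k q, D q -> cpd k u q = 0) -> forall q, D q -> u q = u q0.
Proof.
move=> oD cD Dq0 [u1 u2] du q Dq; apply/eqP; rewrite eq_complex; apply/andP; split; apply/eqP.
  apply: (const_of_pd0 oD cD Dq0 (fun w => smooth_diff u1) _ Dq) => k w Dw.
  by have [] := du k w Dw.
apply: (const_of_pd0 oD cD Dq0 (fun w => smooth_diff u2) _ Dq) => k w Dw.
by have [] := du k w Dw.
Qed.

End ComplexCalculus.

(** * Calculus of matrix-valued functions and the derivative of a determinant *)

Section MatrixCalculus.
Context (R : realType).
Implicit Types (D : set (R * R)) (q : R * R) (k : 'I_2).
Local Notation C := R[i].

Lemma eq_smoothcm D m n (A B : R * R -> 'M[C]_(m, n)) :
  open D -> {in D, A =1 B} -> smoothcm D A -> smoothcm D B.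
Proof.
by move=> oD AB sA i j; apply: (eq_smoothc oD _ (sA i j)) => w Dw; rewrite AB.
Qed.

Lemma smoothcm_cst D m n (A : 'M[C]_(m, n)) : smoothcm D (fun=> A).
Proof. by move=> i j; exact: smoothc_cst. Qed.

Lemma smoothcmD D m n (A B : R * R -> 'M[C]_(m, n)) : open D ->
  smoothcm D A -> smoothcm D B -> smoothcm D (fun w => A w + B w).
Proof. by move=> oD sA sB i j; under eq_fun do rewrite matrix.mxE; exact: smoothcD. Qed.

Lemma smoothcmM D m n p (A : R * R -> 'M[C]_(m, n)) (B : R * R -> 'M[C]_(n, p)) :
  open D -> smoothcm D A -> smoothcm D B -> smoothcm D (fun w => A w *m B w).
Proof.
move=> oD sA sB i j; under eq_fun do rewrite matrix.mxE.
by apply: smoothc_sum => // l; exact: smoothcM.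
Qed.

Lemma smoothcmT D m n (A : R * R -> 'M[C]_(m, n)) :
  smoothcm D A -> smoothcm D (fun w => (A w)^T).
Proof. by move=> sA i j; under eq_fun do rewrite matrix.mxE; exact: sA. Qed.

Lemma smoothcm_conj D m n (A : R * R -> 'M[C]_(m, n)) : open D ->
  smoothcm D A -> smoothcm D (fun w => map_mx conjc (A w)).
Proof. by move=> oD sA i j; under eq_fun do rewrite matrix.mxE; exact: smoothc_conj. Qed.

Lemma smoothcm_cpd D m n k (A : R * R -> 'M[C]_(m, n)) :
  smoothcm D A -> smoothcm D (cpdm k A).
Proof. by move=> sA i j; under eq_fun do rewrite matrix.mxE; exact: smoothc_cpd. Qed.

Lemma smoothc_det D n (A : R * R -> 'M[C]_n) : open D ->
  smoothcm D A -> smoothc D (fun w => \det (A w)).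
Proof.
move=> oD sA; apply: smoothc_sum => // s.
by apply: smoothcM => //; [exact: smoothc_cst|apply: smoothc_prod => // i; exact: sA].
Qed.

Lemma smoothcm_adj D n (A : R * R -> 'M[C]_n) : open D ->
  smoothcm D A -> smoothcm D (fun w => \adj (A w)).
Proof.
move=> oD sA i j; under eq_fun do rewrite matrix.mxE.
apply: smoothcM => //; first exact: smoothc_cst.
by apply: smoothc_det => // a c; under eq_fun do rewrite !matrix.mxE; exact: sA.
Qed.

Lemma eq_cpdm D m n k (A B : R * R -> 'M[C]_(m, n)) q :
  open D -> D q -> {in D, A =1 B} -> cpdm k A q = cpdm k B q.
Proof.
move=> oD Dq AB; apply/matrixP => i j; rewrite !matrix.mxE.
by apply: (eq_cpd k oD Dq) => w Dw; rewrite AB.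
Qed.

Lemma cpdm_cst m n k (A : 'M[C]_(m, n)) q : cpdm k (fun=> A) q = 0.
Proof. by apply/matrixP => i j; rewrite !matrix.mxE cpd_cst. Qed.

Lemma cpdmD D m n k (A B : R * R -> 'M[C]_(m, n)) q :
  smoothcm D A -> smoothcm D B -> D q ->
  cpdm k (fun w => A w + B w) q = cpdm k A q + cpdm k B q.
Proof.
move=> sA sB Dq; apply/matrixP => i j; rewrite !matrix.mxE.
under eq_fun do rewrite matrix.mxE; exact: cpdD (sA i j) (sB i j) Dq.
Qed.

Lemma cpdmM D m n p k (A : R * R -> 'M[C]_(m, n)) (B : R * R -> 'M[C]_(n, p)) q :
  open D -> smoothcm D A -> smoothcm D B -> D q ->
  cpdm k (fun w => A w *m B w) q = cpdm k A q *m B q + A q *m cpdm k B q.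
Proof.
move=> oD sA sB Dq; apply/matrixP => i j; rewrite !matrix.mxE -big_split /=.
under eq_fun do rewrite matrix.mxE.
rewrite (cpd_sum _ _ _ oD _ Dq); last by move=> l; exact: smoothcM.
by apply: eq_bigr => l _; rewrite !matrix.mxE (cpdM k oD (sA i l) (sB l j) Dq).
Qed.

Lemma cpdmT m n k (A : R * R -> 'M[C]_(m, n)) q :
  cpdm k (fun w => (A w)^T) q = (cpdm k A q)^T.
Proof.
by apply/matrixP => i j; rewrite !matrix.mxE; under eq_fun do rewrite matrix.mxE.
Qed.

Lemma cpdm_conj D m n k (A : R * R -> 'M[C]_(m, n)) q :
  smoothcm D A -> D q ->
  cpdm k (fun w => map_mx conjc (A w)) q = map_mx conjc (cpdm k A q).
Proof.
move=> sA Dq; apply/matrixP => i j; rewrite !matrix.mxE.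
under eq_fun do rewrite matrix.mxE; exact: cpd_conj (sA i j) Dq.
Qed.

Lemma cpdmC D m n j k (A : R * R -> 'M[C]_(m, n)) q :
  open D -> smoothcm D A -> D q -> cpdm j (cpdm k A) q = cpdm k (cpdm j A) q.
Proof.
move=> oD sA Dq; apply/matrixP => a c.
have E l : (fun w => cpdm l A w a c) = cpd l (fun w => A w a c).
  by apply/funext => w; rewrite matrix.mxE.
by rewrite [LHS]matrix.mxE [RHS]matrix.mxE !E (cpdC j k oD (sA a c) Dq).
Qed.

(** Differentiating the permutation expansion factor by factor gives a sum of determinants, each
    with one row differentiated; expanding along that row produces the cofactors. *)
Lemma jacobi_formula D n k (A : R * R -> 'M[C]_n) q :
  open D -> smoothcm D A -> D q ->
  cpd k (fun w => \det (A w)) q = \tr (cpdm k A q *m \adj (A q)).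
Proof.
move=> oD sA Dq; rewrite (cpd_sum _ _ _ oD _ Dq); last first.
  by move=> s; apply: smoothcM => //; [exact: smoothc_cst|apply: smoothc_prod => // i; exact: sA].
pose B i := \matrix_(a, c) (if a == i then cpdm k A q a c else A q a c).
transitivity (\sum_i \det (B i)).
  rewrite exchange_big /=; apply: eq_bigr => s _.
  rewrite (cpdM k oD (smoothc_cst _ _) _ Dq); last by apply: smoothc_prod => // i; exact: sA.
  rewrite cpd_cst mul0r add0r -mulr_sumr (cpd_prod k oD _ Dq); last by move=> i; exact: sA.
  congr (_ * _); apply: eq_bigr => i _; apply: eq_bigr => j _.
  by rewrite !matrix.mxE.
apply: eq_bigr => i _; rewrite (expand_det_row _ i) matrix.mxE; apply: eq_bigr => j _.
rewrite !matrix.mxE eqxx; congr (_ * _); rewrite /cofactor; congr (_ * \det _).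
by apply/matrixP => a c; rewrite !matrix.mxE eq_sym (negbTE (neq_lift i a)).
Qed.

Lemma constcm_of_cpdm0 D m n (A : R * R -> 'M[C]_(m, n)) q0 :
  open D -> connected D -> D q0 -> smoothcm D A ->
  (forall k q, D q -> cpdm k A q = 0) -> forall q, D q -> A q = A q0.
Proof.
move=> oD cD Dq0 sA dA q Dq; apply/matrixP => i j.
apply: (constc_of_cpd0 oD cD Dq0 (sA i j) _ Dq) => k w Dw.
by have /matrixP/(_ i j) := dA k w Dw; rewrite !matrix.mxE.
Qed.

End MatrixCalculus.

(** * Four by four matrices given by their entries *)

Section FourByFour.
Context (R : realType).
Local Notation C := R[i].

Lemma big_ord4 (T : nmodType) (f : 'I_4 -> T) :
  \sum_i f i = f o0 + (f o1 + (f o2 + f o3)).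
Proof.
rewrite !big_ord_recl big_ord0 addr0.
by congr (f _ + (f _ + (f _ + f _))); apply: val_inj.
Qed.

Lemma ord4P (P : 'I_4 -> Prop) : P o0 -> P o1 -> P o2 -> P o3 -> forall i, P i.
Proof.
move=> p0 p1 p2 p3 [[|[|[|[|//]]]] Hi].
- by have -> : Ordinal Hi = o0 by apply: val_inj.
- by have -> : Ordinal Hi = o1 by apply: val_inj.
- by have -> : Ordinal Hi = o2 by apply: val_inj.
- by have -> : Ordinal Hi = o3 by apply: val_inj.
Qed.

Lemma mx4_eta (A : 'M[C]_4) : A = mx4
  [:: [:: A o0 o0; A o0 o1; A o0 o2; A o0 o3];
      [:: A o1 o0; A o1 o1; A o1 o2; A o1 o3];
      [:: A o2 o0; A o2 o1; A o2 o2; A o2 o3];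
      [:: A o3 o0; A o3 o1; A o3 o2; A o3 o3]].
Proof. by apply/matrixP; do 2![apply: ord4P]; rewrite matrix.mxE. Qed.

Section Entries.
Variables (a00 a01 a02 a03 a10 a11 a12 a13 a20 a21 a22 a23 a30 a31 a32 a33 : C).
Variables (b00 b01 b02 b03 b10 b11 b12 b13 b20 b21 b22 b23 b30 b31 b32 b33 : C).
Let A := mx4 [:: [:: a00; a01; a02; a03]; [:: a10; a11; a12; a13];
                 [:: a20; a21; a22; a23]; [:: a30; a31; a32; a33]].
Let B := mx4 [:: [:: b00; b01; b02; b03]; [:: b10; b11; b12; b13];
                 [:: b20; b21; b22; b23]; [:: b30; b31; b32; b33]].

Lemma mx4_inj : A = B ->
  [/\ [/\ a00 = b00, a01 = b01, a02 = b02 & a03 = b03],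
      [/\ a10 = b10, a11 = b11, a12 = b12 & a13 = b13],
      [/\ a20 = b20, a21 = b21, a22 = b22 & a23 = b23] &
      [/\ a30 = b30, a31 = b31, a32 = b32 & a33 = b33]].
Proof.
move=> /matrixP AB; have h i j := AB i j.
move: (h o0 o0) (h o0 o1) (h o0 o2) (h o0 o3) (h o1 o0) (h o1 o1) (h o1 o2) (h o1 o3)
  (h o2 o0) (h o2 o1) (h o2 o2) (h o2 o3) (h o3 o0) (h o3 o1) (h o3 o2) (h o3 o3).
by rewrite !matrix.mxE.
Qed.

Lemma mx4M : A *m B = mx4
  [:: [:: a00 * b00 + (a01 * b10 + (a02 * b20 + a03 * b30));
          a00 * b01 + (a01 * b11 + (a02 * b21 + a03 * b31));
          a00 * b02 + (a01 * b12 + (a02 * b22 + a03 * b32));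
          a00 * b03 + (a01 * b13 + (a02 * b23 + a03 * b33))];
      [:: a10 * b00 + (a11 * b10 + (a12 * b20 + a13 * b30));
          a10 * b01 + (a11 * b11 + (a12 * b21 + a13 * b31));
          a10 * b02 + (a11 * b12 + (a12 * b22 + a13 * b32));
          a10 * b03 + (a11 * b13 + (a12 * b23 + a13 * b33))];
      [:: a20 * b00 + (a21 * b10 + (a22 * b20 + a23 * b30));
          a20 * b01 + (a21 * b11 + (a22 * b21 + a23 * b31));
          a20 * b02 + (a21 * b12 + (a22 * b22 + a23 * b32));
          a20 * b03 + (a21 * b13 + (a22 * b23 + a23 * b33))];
      [:: a30 * b00 + (a31 * b10 + (a32 * b20 + a33 * b30));
          a30 * b01 + (a31 * b11 + (a32 * b21 + a33 * b31));
          a30 * b02 + (a31 * b12 + (a32 * b22 + a33 * b32));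
          a30 * b03 + (a31 * b13 + (a32 * b23 + a33 * b33))]].
Proof.
by apply/matrixP; do 2![apply: ord4P]; rewrite matrix.mxE big_ord4 !matrix.mxE.
Qed.

Lemma mx4D : A + B = mx4
  [:: [:: a00 + b00; a01 + b01; a02 + b02; a03 + b03];
      [:: a10 + b10; a11 + b11; a12 + b12; a13 + b13];
      [:: a20 + b20; a21 + b21; a22 + b22; a23 + b23];
      [:: a30 + b30; a31 + b31; a32 + b32; a33 + b33]].
Proof. by apply/matrixP; do 2![apply: ord4P]; rewrite !matrix.mxE. Qed.

Lemma mx4N : - A = mx4
  [:: [:: - a00; - a01; - a02; - a03]; [:: - a10; - a11; - a12; - a13];
      [:: - a20; - a21; - a22; - a23]; [:: - a30; - a31; - a32; - a33]].
Proof. by apply/matrixP; do 2![apply: ord4P]; rewrite !matrix.mxE. Qed.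

Lemma mx4Z c : c *: A = mx4
  [:: [:: c * a00; c * a01; c * a02; c * a03]; [:: c * a10; c * a11; c * a12; c * a13];
      [:: c * a20; c * a21; c * a22; c * a23]; [:: c * a30; c * a31; c * a32; c * a33]].
Proof. by apply/matrixP; do 2![apply: ord4P]; rewrite !matrix.mxE. Qed.

Lemma mx4_tr : A^T = mx4
  [:: [:: a00; a10; a20; a30]; [:: a01; a11; a21; a31];
      [:: a02; a12; a22; a32]; [:: a03; a13; a23; a33]].
Proof. by apply/matrixP; do 2![apply: ord4P]; rewrite !matrix.mxE. Qed.

Lemma mx4_map (f : C -> C) : map_mx f A = mx4
  [:: [:: f a00; f a01; f a02; f a03]; [:: f a10; f a11; f a12; f a13];
      [:: f a20; f a21; f a22; f a23]; [:: f a30; f a31; f a32; f a33]].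
Proof. by apply/matrixP; do 2![apply: ord4P]; rewrite !matrix.mxE. Qed.

Lemma mx4_trace : \tr A = a00 + (a11 + (a22 + a33)).
Proof. by rewrite /mxtrace big_ord4 !matrix.mxE. Qed.

End Entries.

Lemma mx4_scalar (c : C) : c%:M = mx4
  [:: [:: c; 0; 0; 0]; [:: 0; c; 0; 0]; [:: 0; 0; c; 0]; [:: 0; 0; 0; c]].
Proof. by apply/matrixP; do 2![apply: ord4P]; rewrite !matrix.mxE. Qed.

Lemma mx4_0 : mx4
  [:: [:: 0; 0; 0; 0]; [:: 0; 0; 0; 0]; [:: 0; 0; 0; 0]; [:: 0; 0; 0; 0]] = 0 :> 'M[C]_4.
Proof. by apply/matrixP; do 2![apply: ord4P]; rewrite !matrix.mxE. Qed.

(** This is the shape of the matrices commuting with [E]; it covers the elements of [K] and [hatJ1]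
    as well. *)
Lemma det_mx4_block (a x y d b c : C) : \det (mx4
  [:: [:: a; 0; 0; b]; [:: 0; x; 0; 0]; [:: 0; 0; y; 0]; [:: c; 0; 0; d]]) =
  x * y * (a * d - b * c).
Proof.
rewrite (expand_det_row _ o1) big_ord4 !matrix.mxE /= !mul0r add0r !addr0 -mulrA; congr (_ * _).
rewrite /cofactor expr2 mulrNN mulr1 mul1r.
rewrite (expand_det_row _ (@Ordinal 3 1 isT)) !big_ord_recl big_ord0 !matrix.mxE /=.
rewrite !mul0r add0r !addr0; congr (_ * _).
rewrite /cofactor [X in X * _]expr2 mulrNN mulr1 mul1r.
rewrite (expand_det_row _ ord0) !big_ord_recl big_ord0 addr0 /cofactor !det_mx11 !matrix.mxE /=.
by rewrite expr0 expr1 mul1r mulN1r mulrN.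
Qed.

End FourByFour.

Ltac mx4_congr := congr mx4; repeat (congr cons).

(** * The primitive cube root of unity *)

Section RootOfUnity.
Context (R : realType).
Local Notation e := (epsilon R).

(** The angle solves [cos (3 x) = 1], and the triple-angle polynomial [4 c^3 - 3 c - 1] factors as
    [(c - 1) (2 c + 1)^2]; positivity of the sine excludes [c = 1]. *)
Lemma cos_sin_two_thirds_pi : cos (2 * pi / 3) = - 2^-1 :> R /\ sin (2 * pi / 3) ^+ 2 = 3 / 4 :> R.
Proof.
set x : R := 2 * pi / 3.
have s0 : 0 < sin x.
  apply: sin_gt0_pi; rewrite /x; have := pi_gt0 R; lra.
have sc := cos2Dsin2 x.
have c3 : cos (x + (x + x)) = 1.
  have -> : x + (x + x) = pi *+ 2 by rewrite /x mulr2n; lra.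
  exact: cos2pi.
move: c3; rewrite !cosD sinD => c3.
have c : cos x = - 2^-1.
  have /eqP : (cos x - 1) * (2 * cos x + 1) ^+ 2 = 0.
    have ss : sin x ^+ 2 = 1 - cos x ^+ 2 by rewrite -sc; ring.
    have -> : (cos x - 1) * (2 * cos x + 1) ^+ 2 = 4 * cos x ^+ 3 - 3 * cos x - 1 by ring.
    rewrite -[X in _ - X]c3.
    have -> : cos x * (cos x * cos x - sin x * sin x) - sin x * (sin x * cos x + cos x * sin x)
      = cos x ^+ 3 - 3 * cos x * sin x ^+ 2 by ring.
    rewrite ss; ring.
  rewrite mulf_eq0 expf_eq0 /= => /orP[|/eqP c]; last by lra.
  rewrite subr_eq0 => /eqP c1; move: sc; rewrite c1 expr1n => /eqP.
  by rewrite eq_sym addrC -subr_eq subrr eq_sym expf_eq0 /= gt_eqF.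
split=> //; have -> : sin x ^+ 2 = 1 - cos x ^+ 2 by rewrite -sc; ring.
by rewrite c; field.
Qed.

Lemma conj_epsilon : conjc e = e * e.
Proof.
have [c s] := cos_sin_two_thirds_pi.
apply/eqP; rewrite eq_complex /epsilon /= -[X in _ - X]expr2 s c.
by apply/andP; split; apply/eqP; field.
Qed.

Lemma epsilon3 : e * e * e = 1.
Proof.
have [c s] := cos_sin_two_thirds_pi.
rewrite -conj_epsilon; apply/eqP; rewrite eq_complex /epsilon /=.
rewrite mulNr opprK -!expr2 s c; apply/andP; split; apply/eqP; by field.
Qed.

Lemma epsilon_neq1 : e != 1.
Proof.
have [c _] := cos_sin_two_thirds_pi.
rewrite eq_complex /epsilon /= c negb_and; apply/orP; left; apply/eqP; lra.
Qed.

Lemma epsilon2_neq1 : e * e != 1.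
Proof.
apply/eqP => e2; have := epsilon3; rewrite e2 mul1r => e1.
by have := epsilon_neq1; rewrite e1 eqxx.
Qed.

Lemma Nepsilon_neq1 : - e != 1.
Proof.
have [c _] := cos_sin_two_thirds_pi.
rewrite eq_complex /epsilon /= c negb_and; apply/orP; left; apply/eqP; lra.
Qed.

Lemma Nepsilon2_neq1 : - (e * e) != 1.
Proof.
have [c _] := cos_sin_two_thirds_pi.
rewrite -conj_epsilon eq_complex /epsilon /= c negb_and; apply/orP; left; apply/eqP; lra.
Qed.

End RootOfUnity.

Lemma invmx_uniq (R : realType) n (A B : 'M[R[i]]_n) : A *m B = 1%:M -> invmx A = B.
Proof. by move=> AB; have [u _] := mulmx1_unit AB; rewrite -[RHS](mulKmx u) AB mulmx1. Qed.

(** * The Killing form in terms of traces *)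

Section Killing.
Context (R : realType).
Local Notation C := R[i].

Lemma mul_delta_mx_mul n (A B : 'M[C]_n) i j k l :
  (A *m delta_mx i j *m B) k l = A k i * B j l.
Proof.
have Aij : (A *m delta_mx i j) k j = A k i.
  rewrite matrix.mxE (bigD1 i)//= matrix.mxE !eqxx mulr1 big1 ?addr0// => m /negbTE mi.
  by rewrite matrix.mxE mi mulr0.
rewrite matrix.mxE (bigD1 j)//= Aij big1 ?addr0// => m /negbTE mj.
rewrite matrix.mxE big1 ?mul0r// => m' _.
by rewrite matrix.mxE mj andbF mulr0.
Qed.

Lemma trace_lin_mx n (f : 'M[C]_n -> 'M[C]_n) :
  \tr (lin_mx f) = \sum_i \sum_j f (delta_mx i j) i j.
Proof.
rewrite pair_big /= /mxtrace (reindex _ (curry_mxvec_bij n n)) /=.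
apply: eq_bigr => -[i j] _ /=.
by rewrite /lin_mx /lin1_mx matrix.mxE /= mxvecE vec_mx_delta.
Qed.

(** The general form on n by n matrices is [2 n tr (X Y) - 2 tr X tr Y]. The trace of an operator on
    matrices is read on the elementary matrices, where the double bracket has four terms, each a
    product of two diagonal or Kronecker factors. *)
Lemma killingE (X Y : 'M[C]_4) :
  killing X Y = 8 * \tr (X *m Y) - 2 * (\tr X * \tr Y).
Proof.
rewrite /killing trace_lin_mx.
have E i j : bracket X (bracket Y (delta_mx i j)) i j =
    (X *m Y) i i - X i i * Y j j - Y i i * X j j + (Y *m X) j j.
  rewrite /bracket mulmxBr mulmxBl !mulmxA.
  have h (A B : 'M[C]_4) := mul_delta_mx_mul A B i j i j.
  have h1 := h (X *m Y) 1%:M; rewrite mulmx1 in h1.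
  have h2 := h 1%:M (Y *m X); rewrite mul1mx mulmxA in h2.
  have sub4 (A B P Q : 'M[C]_4) : (A - B - (P - Q)) i j = A i j - B i j - (P i j - Q i j).
    by rewrite !matrix.mxE.
  rewrite sub4.
  rewrite h1 h2 !h !matrix.mxE !eqxx !mulr1 !mul1r; ring.
transitivity (\sum_i \sum_j ((X *m Y) i i - X i i * Y j j - Y i i * X j j + (Y *m X) j j)).
  by apply: eq_bigr => i _; apply: eq_bigr => j _; exact: E.
transitivity (\sum_(i < 4) (4 * (X *m Y) i i - X i i * \tr Y - Y i i * \tr X + \tr (Y *m X))).
  apply: eq_bigr => i _; rewrite !big_split /= !sumrN -!mulr_sumr sumr_const card_ord.
  by rewrite -[(X *m Y) i i *+ 4]mulr_natl.
rewrite !big_split /= !sumrN -!mulr_sumr -!mulr_suml sumr_const card_ord.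
rewrite -[_ *+ 4]mulr_natl (mxtrace_mulC Y X) -!/(mxtrace _); ring.
Qed.

End Killing.

(** * The real form [G] as the fixed points of a conjugation *)

Section Unitary.
Context (R : realType).
Local Notation C := R[i].
Local Notation L := (mxL R).
Local Notation J := (mxJ1 R).
Local Notation e := (epsilon R).
Implicit Types X Y a c : 'M[C]_4.

Lemma conjcM (x y : C) : conjc (x * y) = conjc x * conjc y.
Proof. exact: (rmorphM (@conjc R)). Qed.

Lemma conjcD (x y : C) : conjc (x + y) = conjc x + conjc y.
Proof. exact: (rmorphD (@conjc R)). Qed.

Lemma conjcN (x : C) : conjc (- x) = - conjc x.
Proof. exact: (rmorphN (@conjc R)). Qed.

Lemma conjc_fixed (x : C) : conjc x = x -> (complex.Re x)%:C = x.
Proof.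
case: x => x y /eqP; rewrite eq_complex /= => /andP[_].
by rewrite eq_sym -addr_eq0 -mulr2n mulrn_eq0 /= => /eqP ->.
Qed.

Definition mxPi : 'M[C]_4 :=
  mx4 [:: [:: 1; 0; 0; 0]; [:: 0; 0; 1; 0]; [:: 0; 1; 0; 0]; [:: 0; 0; 0; 1]].

(* [Pi] exchanges the columns of [L] that are conjugate to each other, so the
   matrices fixed by [bar] are exactly the [L^-1 A L] with [A] real. *)
Definition bar X : 'M[C]_4 := mxPi *m map_mx conjc X *m mxPi.

Definition ctr m n (X : 'M[C]_(m, n)) : 'M[C]_(n, m) := map_mx conjc X^T.

Lemma ctrM m n p (X : 'M[C]_(m, n)) (Y : 'M[C]_(n, p)) : ctr (X *m Y) = ctr Y *m ctr X.
Proof. by rewrite /ctr trmx_mul map_mxM. Qed.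

Lemma mxPi2 : mxPi *m mxPi = 1%:M.
Proof. rewrite /mxPi mx4M mx4_scalar; mx4_congr; ring. Qed.

(** Here [t] is the inverse square root of 2 and [r] is [i t]. Only their squares and conjugates
    matter, so the square root itself disappears from later computations. *)
Lemma mxL_explicit : exists t r : C, [/\ t * t = 2^-1, r * r = - 2^-1,
  conjc t = t, conjc r = - r & L = mx4
  [:: [:: 1; 0; 0; 0]; [:: 0; r; - r; 0]; [:: 0; t; t; 0]; [:: 0; 0; 0; 1]]].
Proof.
have s2 : (Num.sqrt 2)%:C * (Num.sqrt 2)%:C = 2 :> C.
  by rewrite -rmorphM -expr2 sqr_sqrtr ?ler0n// rmorph_nat.
have s0 : (Num.sqrt 2)%:C != 0 :> C.
  by apply/eqP => s0; move/eqP: s2; rewrite s0 mul0r eq_sym pnatr_eq0.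
have cs : conjc (Num.sqrt 2)%:C = (Num.sqrt 2)%:C :> C by rewrite conjc_real.
rewrite /mxL; set s := (Num.sqrt 2)%:C in s2 s0 cs *.
have ct : conjc s^-1 = s^-1 by rewrite conjc_inv cs.
have ii : ci R * ci R = -1 by rewrite -expr2 sqr_i.
have ci' : conjc (ci R) = - ci R by apply/eqP; rewrite eq_complex /= oppr0 !eqxx.
have tt : s^-1 * s^-1 = 2^-1 by rewrite -invfM s2.
exists s^-1, (s^-1 * ci R); split=> //.
- have -> : s^-1 * ci R * (s^-1 * ci R) = s^-1 * s^-1 * (ci R * ci R) by ring.
  by rewrite tt ii mulrN1.
- by rewrite conjcM ct ci' mulrN.
- by rewrite mx4Z; mx4_congr; rewrite ?mulr0 ?mulr1 ?mulrN ?mulVf.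
Qed.

Lemma mxL_unitary : ctr L *m L = 1%:M.
Proof.
have [t [r [tt rr ct cr ->]]] := mxL_explicit.
rewrite /ctr mx4_tr mx4_map !(conjc0, conjc1, conjcN) ct cr mx4M mx4_scalar.
mx4_congr; rewrite ?mulr0 ?mul0r ?addr0 ?add0r ?mulr1 // ?mulNr ?mulrN ?opprK ?tt ?rr; by field.
Qed.

Lemma mxL_unit : L \in unitmx.
Proof. by have [] := mulmx1_unit mxL_unitary. Qed.

Lemma conj_mxL : map_mx conjc L = L *m mxPi.
Proof.
have [t [r [_ _ ct cr ->]]] := mxL_explicit.
rewrite /mxPi mx4_map mx4M !(conjc0, conjc1, conjcN) ct cr.
mx4_congr; ring.
Qed.

Lemma hatJ1E : hatJ1 R =
  mx4 [:: [:: 0; 0; 0; 1]; [:: 0; 1; 0; 0]; [:: 0; 0; 1; 0]; [:: 1; 0; 0; 0]].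
Proof.
rewrite /hatJ1 /mxJ1; have [t [r [tt rr ct cr ->]]] := mxL_explicit.
rewrite mx4_tr !mx4M.
mx4_congr; rewrite ?mulr0 ?mul0r ?addr0 ?add0r ?mulr1 ?mul1r //.
all: by rewrite ?mulNr ?mulrN ?opprK ?tt ?rr; field.
Qed.

Lemma barM X Y : bar (X *m Y) = bar X *m bar Y.
Proof. by rewrite /bar map_mxM !mulmxA -(mulmxA _ mxPi mxPi) mxPi2 mulmx1. Qed.

Lemma barE (a00 a01 a02 a03 a10 a11 a12 a13 a20 a21 a22 a23 a30 a31 a32 a33 : C) :
  bar (mx4 [:: [:: a00; a01; a02; a03]; [:: a10; a11; a12; a13];
               [:: a20; a21; a22; a23]; [:: a30; a31; a32; a33]]) =
  mx4 [:: [:: conjc a00; conjc a02; conjc a01; conjc a03];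
          [:: conjc a20; conjc a22; conjc a21; conjc a23];
          [:: conjc a10; conjc a12; conjc a11; conjc a13];
          [:: conjc a30; conjc a32; conjc a31; conjc a33]].
Proof. rewrite /bar /mxPi mx4_map !mx4M; mx4_congr; ring. Qed.

Lemma bar_tr X : bar X^T = (bar X)^T.
Proof.
have PT : mxPi^T = mxPi by rewrite /mxPi mx4_tr.
by rewrite /bar !trmx_mul PT map_trmx mulmxA.
Qed.

Lemma bar_ctr X : bar (ctr X) = ctr (bar X).
Proof. by rewrite /ctr (mx4_eta X) mx4_tr mx4_map !barE mx4_tr mx4_map. Qed.

Lemma bar1 : bar 1%:M = 1%:M.
Proof. by rewrite /bar map_mx1 mulmx1 mxPi2. Qed.

Lemma bar_invmx X : X \in unitmx -> bar (invmx X) = invmx (bar X).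
Proof.
by move=> uX; apply/esym/invmx_uniq; rewrite -barM (mulmxV uX) bar1.
Qed.

Lemma cplx_Re X : map_mx conjc X = X -> cplx (map_mx (@complex.Re R) X) = X.
Proof.
move=> /matrixP cX; apply/matrixP => i j; have := cX i j; rewrite !matrix.mxE.
exact: conjc_fixed.
Qed.

Lemma barP X : bar X = X <-> exists A : 'M[R]_4, X = invmx L *m cplx A *m L.
Proof.
have cL : map_mx conjc (invmx L) = mxPi *m invmx L.
  have uLP : L *m mxPi \in unitmx.
    by rewrite unitmx_mul mxL_unit; have [] := mulmx1_unit mxPi2.
  have LPPL : L *m mxPi *m (mxPi *m invmx L) = 1%:M.
    by rewrite mulmxA -(mulmxA L) mxPi2 mulmx1 mulmxV// mxL_unit.
  by rewrite map_invmx /= conj_mxL -[RHS](mulKmx uLP) LPPL mulmx1.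
split=> [bX|[A ->]]; last first.
  rewrite /bar !map_mxM /= cL conj_mxL !mulmxA mxPi2 mul1mx -!mulmxA mxPi2 mulmx1.
  by congr (_ *m (_ *m _)); apply/matrixP => i j; rewrite !matrix.mxE conjc_real.
(* As [conj L = L Pi], invariance of [X] under [bar] says exactly that [Y] is a real matrix. *)
pose Y := L *m X *m invmx L.
have cY : map_mx conjc Y = Y.
  rewrite /Y !map_mxM /= cL conj_mxL -[in RHS]bX /bar !mulmxA; congr (_ *m _).
exists (map_mx (@complex.Re R) Y).
have -> : cplx (map_mx (@complex.Re R) Y) = Y.
  exact: cplx_Re.
by rewrite /Y !mulmxA mulVmx ?mxL_unit// mul1mx mulmxKV// mxL_unit.
Qed.

Lemma det_conjL (A : 'M[C]_4) : \det (invmx L *m A *m L) = \det A.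
Proof. 
rewrite !det_mulmx det_inv mulrC mulrA divff ?mul1r//.
by have := mxL_unit; rewrite unitmxE unitfE.
Qed.

(** Membership becomes two equations, which can be checked on entries and propagated along the frame
    by differentiation. *)
Lemma grpGP X : grpG X <-> \det X = 1 /\ bar X = X.
Proof.
split=> [[A dA ->]|[dX /barP[A eX]]].
  split; last by apply/barP; exists A.
  by rewrite det_conjL det_map_mx dA rmorph1.
exists A => //; apply: (@complexI R); rewrite -det_map_mx -[RHS]/(1 : C) -dX eX det_conjL.
by [].
Qed.

Lemma lieGP X : lieG X <-> \tr X = 0 /\ bar X = X.
Proof.
have trL (A : 'M[C]_4) : \tr (invmx L *m A *m L) = \tr A.
  by rewrite mxtrace_mulC mulmxA mulmxV ?mxL_unit// mul1mx.
split=> [[A tA ->]|[tX /barP[A eX]]].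
  split; last by apply/barP; exists A.
  by rewrite trL trace_map_mx tA rmorph0.
exists A => //; apply: (@complexI R); rewrite -trace_map_mx -[RHS]/(0 : C) -tX eX trL.
by [].
Qed.

Lemma lieG_ctr X : lieG X -> lieG (ctr X).
Proof.
move=> /lieGP[tX bX]; apply/lieGP; rewrite bar_ctr bX; split=> //.
by rewrite /ctr trace_map_mx mxtrace_tr tX rmorph0.
Qed.

Lemma trace_ctr_eq0 X : \tr (X *m ctr X) = 0 -> X = 0.
Proof.
move=> /eqP; rewrite /mxtrace.
have E i : (X *m ctr X) i i = \sum_j `|X i j| ^+ 2.
  rewrite matrix.mxE; apply: eq_bigr => j _; rewrite !matrix.mxE.
  by rewrite normCK.
under eq_bigr do rewrite E.
rewrite psumr_eq0; last by move=> i _; apply: sumr_ge0 => j _; rewrite exprn_ge0.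
move=> /allP h; apply/matrixP => i j; rewrite matrix.mxE.
have := h i (mem_index_enum i); rewrite psumr_eq0; last by move=> k _; rewrite exprn_ge0.
by move=> /allP/(_ j (mem_index_enum j)) /=; rewrite expf_eq0 normr_eq0 => /eqP.
Qed.

(* For trace-free X the Killing form pairs X with its conjugate transpose to
   8 |X|^2. *)
Lemma killing_nondegenerate (V : set 'M[C]_4) :
  (forall X, V X -> \tr X = 0) -> (forall X, V X -> V (ctr X)) ->
  nondegenerate_on V (@killing R).
Proof.
move=> Vtr Vctr X VX /(_ (ctr X) (Vctr X VX)).
rewrite killingE (Vtr X VX) mul0r mulr0 subr0 => /eqP.
by rewrite mulf_eq0 pnatr_eq0 /= => /eqP /trace_ctr_eq0.
Qed.

End Unitary.

(** A proper period would divide 2 or 3, the maximal proper divisors of 6, so only these two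
    iterates have to be tested. *)
Lemma iter_order6 (T : Type) (g : T -> T) (x : T) (j : nat) : iter 6 g x = x ->
  g (g x) <> x -> g (g (g x)) <> x -> (0 < j < 6)%N -> iter j g x <> x.
Proof.
move=> /= g6 g2 g3; case: j => [//|[|[|[|[|[|//]]]]]] _ /= h.
- by apply: g2; rewrite h.
- exact: g2 h.
- exact: g3 h.
- by apply: g2; move: g6; rewrite h.
- have gx : g x = x by move: g6; rewrite h.
  by apply: g2; rewrite !gx.
Qed.

Lemma iter6_inj (T : Type) (g : T -> T) (x y : T) :
  iter 6 g x = x -> iter 6 g y = y -> g x = g y -> x = y.
Proof. by move=> gx gy gxy; rewrite -gx -gy !iterSr gxy. Qed.

(** * The automorphism of order six and its symmetric space *)

Section SymmetricSpace.
Context (R : realType).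
Local Notation C := R[i].
Local Notation L := (mxL R).
Local Notation J := (mxJ1 R).
Local Notation E := (Defs.mxE R).
Local Notation e := (epsilon R).
Implicit Types X Y a c : 'M[C]_4.

Let e3 : e * e * e = 1 := epsilon3 R.

Definition mxEc : 'M[C]_4 :=
  mx4 [:: [:: 1; 0; 0; 0]; [:: 0; e; 0; 0]; [:: 0; 0; e * e; 0]; [:: 0; 0; 0; 1]].

Lemma mxE_mul : E *m mxEc = 1%:M.
Proof.
rewrite /Defs.mxE /mxEc mx4M mx4_scalar expr2; mx4_congr; try ring; rewrite -e3; ring.
Qed.

Lemma mxE_unit : E \in unitmx. Proof. by have [] := mulmx1_unit mxE_mul. Qed.

Lemma invmx_mxE : invmx E = mxEc.
Proof. exact: invmx_uniq mxE_mul. Qed.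

Lemma mxJ_mul : J *m J = 1%:M.
Proof. rewrite /mxJ1 mx4M mx4_scalar; mx4_congr; ring. Qed.

Lemma mxJ_tr : J^T = J. Proof. by rewrite /mxJ1 mx4_tr. Qed.

Lemma mxE_tr : E^T = E. Proof. by rewrite /Defs.mxE mx4_tr. Qed.

Lemma mxEc_tr : mxEc^T = mxEc. Proof. by rewrite /mxEc mx4_tr. Qed.

(** Conjugation by [J] inverts [E], as the inverse transpose does; hence [tau1] and [sigma]
    commute. *)
Lemma mxJEJ : J *m mxEc = E *m J.
Proof. rewrite /mxJ1 /mxEc /Defs.mxE !mx4M expr2; mx4_congr; ring. Qed.

Lemma mxEEE : E *m E *m E = 1%:M.
Proof.
rewrite /Defs.mxE !mx4M mx4_scalar; mx4_congr; try ring.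
  have -> : e ^+ 2 = e * e by rewrite expr2.
  have -> : 1 = (e * e * e) * (e * e * e) by rewrite e3 mulr1.
  ring.
rewrite -e3; ring.
Qed.

Lemma mxEcEE : mxEc *m mxEc *m mxEc = 1%:M.
Proof.
rewrite /mxEc !mx4M mx4_scalar; mx4_congr; try ring.
  rewrite -e3; ring.
have -> : 1 = (e * e * e) * (e * e * e) by rewrite e3 mulr1.
ring.
Qed.

Lemma bar_mxE : bar E = E.
Proof.
have c2 : conjc (e ^+ 2) = e.
  rewrite expr2 conjcM conj_epsilon.
  have -> : e * e * (e * e) = e * e * e * e by ring.
  by rewrite e3 mul1r.
by rewrite /Defs.mxE barE !(conjc0, conjc1) c2 conj_epsilon -expr2.
Qed.

Lemma bar_mxJ : bar J = J.
Proof. by rewrite /mxJ1 barE !(conjc0, conjc1). Qed.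

Lemma bar_mxEc : bar mxEc = mxEc.
Proof. by rewrite -invmx_mxE bar_invmx ?mxE_unit// bar_mxE. Qed.

Lemma sigmaM a c : sigma (a *m c) = sigma a *m sigma c.
Proof. by rewrite /sigma !mulmxA mulmxKV// mxE_unit. Qed.

Lemma det_sigma a : \det (sigma a) = \det a.
Proof.
rewrite /sigma !det_mulmx det_inv mulrC mulrA mulVr ?mul1r//.
by rewrite -unitmxE mxE_unit.
Qed.

Lemma sigma_unit a : a \in unitmx -> sigma a \in unitmx.
Proof. by rewrite !unitmxE det_sigma. Qed.

Lemma sigma3 a : sigma (sigma (sigma a)) = a.
Proof.
rewrite /sigma invmx_mxE !mulmxA mxEEE mul1mx -!mulmxA.
by rewrite (mulmxA mxEc) mxEcEE mulmx1.
Qed.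

Lemma tau1M a c : a \in unitmx -> c \in unitmx -> tau1 (a *m c) = tau1 a *m tau1 c.
Proof.
move=> ua uc; rewrite /tau1 trmx_mul.
have -> : invmx (c^T *m a^T) = invmx a^T *m invmx c^T.
  have [uaT ucT] : a^T \in unitmx /\ c^T \in unitmx by rewrite !unitmx_tr.
  by apply: invmx_uniq; rewrite -!mulmxA (mulmxA a^T) (mulmxV uaT) mul1mx (mulmxV ucT).
by rewrite !mulmxA -(mulmxA _ J J) mxJ_mul mulmx1.
Qed.

Lemma mxJ_unit : J \in unitmx. Proof. by have [] := mulmx1_unit mxJ_mul. Qed.

Lemma tau1_unit a : a \in unitmx -> tau1 a \in unitmx.
Proof. by move=> ua; rewrite /tau1 !unitmx_mul mxJ_unit unitmx_inv unitmx_tr ua. Qed.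

Lemma tau1K a : a \in unitmx -> tau1 (tau1 a) = a.
Proof.
move=> ua; have u2 := tau1_unit ua.
rewrite {1}/tau1; have -> : (tau1 a)^T = J *m invmx a *m J.
  by rewrite /tau1 !trmx_mul mxJ_tr trmx_inv trmxK mulmxA.
have -> : invmx (J *m invmx a *m J) = J *m a *m J.
  apply: invmx_uniq; rewrite !mulmxA -(mulmxA _ J J) mxJ_mul mulmx1.
  by rewrite -(mulmxA J (invmx a)) (mulVmx ua) mulmx1 mxJ_mul.
by rewrite !mulmxA mxJ_mul mul1mx -mulmxA mxJ_mul mulmx1.
Qed.

Lemma kappa_sigma_tau1 a : a \in unitmx -> kappa a = sigma (tau1 a).
Proof.
move=> ua; rewrite /kappa /tau1 {1}/sigma.
have -> : invmx (E *m a *m invmx E)^T = mxEc *m invmx a^T *m E.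
  rewrite invmx_mxE !trmx_mul mxE_tr mxEc_tr.
  have uaT : a^T \in unitmx by rewrite unitmx_tr.
  apply: invmx_uniq; rewrite -!mulmxA (mulmxA E) mxE_mul mul1mx.
  by rewrite (mulmxA a^T) (mulmxV uaT) mul1mx -invmx_mxE (mulVmx mxE_unit).
have h A : J *m (mxEc *m A *m E) *m J = (J *m mxEc) *m A *m (E *m J) by rewrite !mulmxA.
by rewrite h mxJEJ -{2}mxJEJ /sigma invmx_mxE !mulmxA.
Qed.

(** The involution [tau1] cancels by commutation. Invertibility is assumed because [invmx] inverts
    nothing outside the units. *)
Lemma kappa2 a : a \in unitmx -> kappa (kappa a) = sigma (sigma a).
Proof.
move=> ua; rewrite {2}/kappa kappa_sigma_tau1 ?tau1K ?sigma_unit//.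
by rewrite tau1_unit// sigma_unit.
Qed.

Lemma iter6_kappa a : a \in unitmx -> iter 6 (@kappa R) a = a.
Proof.
move=> ua; rewrite /= !kappa2 ?sigma_unit// !sigma3.
by [].
Qed.

Lemma grpG_unit a : grpG a -> a \in unitmx.
Proof. by move=> /grpGP[da _]; rewrite unitmxE da unitr1. Qed.

Lemma kappaM a c : a \in unitmx -> c \in unitmx -> kappa (a *m c) = kappa a *m kappa c.
Proof. by move=> ua uc; rewrite /kappa sigmaM tau1M ?sigma_unit. Qed.

Lemma grpG_kappa a : grpG a -> grpG (kappa a).
Proof.
move=> Ga; have ua := grpG_unit Ga; move/grpGP: Ga => [da ba].
have dJ : \det J * \det J = 1 by rewrite -det_mulmx mxJ_mul det1.
rewrite kappa_sigma_tau1//; apply/grpGP; rewrite det_sigma; split.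
  by rewrite /tau1 !det_mulmx det_inv det_tr da invr1 mulr1.
have uaT : a^T \in unitmx by rewrite unitmx_tr.
rewrite /sigma /tau1 invmx_mxE !barM bar_mxE bar_mxJ bar_mxEc (bar_invmx uaT) bar_tr ba.
reflexivity.
Qed.

Lemma set_bij_kappa : set_bij (@grpG R) (@grpG R) (@kappa R).
Proof.
split.
- by move=> a Ga; exact: grpG_kappa.
- move=> a c /set_mem Ga /set_mem Gc ac.
  exact: iter6_inj (iter6_kappa (grpG_unit Ga)) (iter6_kappa (grpG_unit Gc)) ac.
- move=> a Ga; exists (iter 5 (@kappa R) a).
    by rewrite /=; do 5!apply: grpG_kappa.
  by rewrite -iterS; exact/iter6_kappa/grpG_unit.
Qed.

Lemma order_kappa : order_on (@grpG R) (@kappa R) 6.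
Proof.
split=> // [a Ga|j jP]; first exact/iter6_kappa/grpG_unit.
(* The two off-diagonal ones are exchanged by [bar], so [N] lies in [G]. The second iterate
   multiplies the entry (0, 1) by [e^2], and the third, which is [tau1], makes it zero. [N'] is the
   inverse transpose. *)
pose N : 'M[C]_4 := mx4 [:: [:: 1; 1; 1; 0]; [:: 0; 1; 0; 0]; [:: 0; 0; 1; 0]; [:: 0; 0; 0; 1]].
pose N' : 'M[C]_4 :=
  mx4 [:: [:: 1; 0; 0; 0]; [:: -1; 1; 0; 0]; [:: -1; 0; 1; 0]; [:: 0; 0; 0; 1]].
have NN' : N^T *m N' = 1%:M.
  by rewrite /N /N' mx4_tr mx4M mx4_scalar; mx4_congr; ring.
have dN : \det N = 1.
  rewrite -det_tr det_trig; last first.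
    by apply/is_trig_mxP; do 2![apply: ord4P] => //= _; rewrite !matrix.mxE.
  by rewrite !big_ord_recl big_ord0 !matrix.mxE /= !mulr1.
have GN : grpG N.
  by apply/grpGP; split=> //; rewrite /N barE !(conjc0, conjc1).
exists N; first exact: GN.
have uN := grpG_unit GN.
have iN : invmx N^T = N'.
  exact: invmx_uniq NN'.
have k2 : kappa (kappa N) <> N.
  rewrite kappa2// /sigma invmx_mxE /Defs.mxE /mxEc /N !mx4M => /mx4_inj[[_ h _ _] _ _ _].
  have : e * e = 1 by rewrite -[RHS]h; ring.
  by apply/eqP/epsilon2_neq1.
have k3 : kappa (kappa (kappa N)) <> N.
  rewrite kappa2; last exact/grpG_unit/grpG_kappa.
  rewrite kappa_sigma_tau1// sigma3 /tau1 iN /mxJ1 /N' !mx4M => /mx4_inj[[_ h _ _] _ _ _].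
  have : 0 = 1 :> C by rewrite -[RHS]h; ring.
  by apply/eqP; rewrite eq_sym oner_eq0.
exact: iter_order6 (iter6_kappa uN) k2 k3 jP.
Qed.

Definition mxK (k1 k2 : C) : 'M[C]_4 :=
  mx4 [:: [:: k1; 0; 0; 0]; [:: 0; k2; 0; 0]; [:: 0; 0; k2^-1; 0]; [:: 0; 0; 0; k1^-1]].

Lemma mxKM k1 k2 l1 l2 : mxK k1 k2 *m mxK l1 l2 = mxK (k1 * l1) (k2 * l2).
Proof. rewrite /mxK mx4M !invfM; mx4_congr; ring. Qed.

Lemma mxK1 : mxK 1 1 = 1%:M.
Proof. by rewrite /mxK mx4_scalar invr1. Qed.

Lemma invmx_mxK k1 k2 : k1 != 0 -> k2 != 0 -> invmx (mxK k1 k2) = mxK k1^-1 k2^-1.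
Proof.
move=> k10 k20; have h : mxK k1 k2 *m mxK k1^-1 k2^-1 = 1%:M.
  by rewrite mxKM !divff// mxK1.
exact: invmx_uniq h.
Qed.

Lemma norm1_conjc (x : C) : `|x| = 1 -> conjc x = x^-1.
Proof.
move=> x1; have x0 : x != 0 by rewrite -normr_eq0 x1 oner_eq0.
apply: (mulfI x0); rewrite divff//.
have := normCK x; rewrite x1 expr1n => ->.
by [].
Qed.

(** Reality of [k1] and unit modulus of [k2] are restated as conjugation equations, which are closed
    under products and inverses by rewriting. *)
Lemma grpKP a : grpK a <-> exists k1 k2 : C,
  [/\ conjc k1 = k1, k1 != 0, conjc k2 = k2^-1, k2 != 0 & a = mxK k1 k2].
Proof.
split=> [[k1 [k2 [k10 k21 ->]]]|[k1 [k2 [ck1 k10 ck2 k20 ->]]]].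
  exists k1%:C, k2; split=> //.
  - by rewrite conjc_real.
  - by rewrite eq_complex /= eqxx andbT.
  - exact: norm1_conjc.
  - by rewrite -normr_eq0 k21 oner_eq0.
exists (complex.Re k1), k2.
have e1 : (complex.Re k1)%:C = k1.
  exact: conjc_fixed.
split.
- by apply: contraNneq k10 => h; rewrite -e1 h.
- apply/eqP; rewrite -(@eqrXn2 _ 2)// ?normr_ge0// expr1n normCK.
  by apply/eqP; rewrite -[X in _ * X]/(conjc k2) ck2 divff.
- by rewrite e1.
Qed.

Lemma grpK_group : @grpK R 1%:M /\ forall a c, grpK a -> grpK c -> grpK (invmx a *m c).
Proof.
split.
  apply/grpKP; exists 1, 1; rewrite mxK1 !oner_eq0 invr1 conjc1; split=> //.
move=> a c /grpKP[k1 [k2 [ck1 k10 ck2 k20 ->]]] /grpKP[l1 [l2 [cl1 l10 cl2 l20 ->]]].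
apply/grpKP; exists (k1^-1 * l1), (k2^-1 * l2); rewrite invmx_mxK// mxKM; split=> //.
- by rewrite conjcM conjc_inv ck1 cl1.
- by rewrite mulf_neq0// invr_neq0.
- by rewrite conjcM conjc_inv ck2 cl2 invfM.
- by rewrite mulf_neq0// invr_neq0.
Qed.

Lemma mxK_J k1 k2 : k1 != 0 -> k2 != 0 -> mxK k1 k2 *m J *m (mxK k1 k2)^T = J.
Proof.
move=> k10 k20; rewrite /mxK /mxJ1 mx4_tr !mx4M.
by mx4_congr; try ring; field; rewrite ?k10 ?k20.
Qed.

Lemma grpK_sub_fixed : @grpK R `<=` fixed_in (@grpG R) (@kappa R).
Proof.
move=> a /grpKP[k1 [k2 [ck1 k10 ck2 k20 ->]]].
have GK : grpG (mxK k1 k2).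
  apply/grpGP; split; first by rewrite /mxK det_mx4_block; field; rewrite k10 k20.
  by rewrite /mxK barE !(conjc0, conjc1) !conjc_inv ck1 ck2 invrK.
split=> //; rewrite kappa_sigma_tau1 ?grpG_unit//.
have -> : tau1 (mxK k1 k2) = mxK k1 k2.
  have KT : (mxK k1 k2)^T = mxK k1 k2 by rewrite /mxK mx4_tr.
  rewrite /tau1 KT invmx_mxK// /mxK /mxJ1 !mx4M !invrK; mx4_congr; ring.
rewrite /sigma invmx_mxE /Defs.mxE /mxK /mxEc !mx4M expr2; mx4_congr; try ring.
  transitivity (e * e * e * k2); [ring|by rewrite e3 mul1r].
transitivity (e * e * e * k2^-1); [ring|by rewrite e3 mul1r].
Qed.

(** An entry of a fixed matrix that the automorphism multiplies by a nontrivial root of unity must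
    vanish. *)
Lemma eq_mul_neq1 (c x y : C) : y = x -> y = c * x -> c != 1 -> x = 0.
Proof.
move=> -> h c1; apply/eqP; have : (c - 1) * x = 0 by rewrite mulrBl -h mul1r subrr.
by move=> /eqP; rewrite mulf_eq0 subr_eq0 (negbTE c1).
Qed.

(** The eigenvalue 1 of [E] is double, on coordinates 0 and 3, and the other two are simple; a
    matrix commuting with [E] preserves these eigenspaces. *)
Lemma sigma_fixed X : sigma X = X -> exists a x y d b c : C, X =
  mx4 [:: [:: a; 0; 0; b]; [:: 0; x; 0; 0]; [:: 0; 0; y; 0]; [:: c; 0; 0; d]].
Proof.
rewrite (mx4_eta X) /sigma invmx_mxE /Defs.mxE /mxEc !mx4M.
move: (X o0 o0) (X o0 o1) (X o0 o2) (X o0 o3) => x00 x01 x02 x03.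
move: (X o1 o0) (X o1 o1) (X o1 o2) (X o1 o3) => x10 x11 x12 x13.
move: (X o2 o0) (X o2 o1) (X o2 o2) (X o2 o3) => x20 x21 x22 x23.
move: (X o3 o0) (X o3 o1) (X o3 o2) (X o3 o3) => x30 x31 x32 x33.
move=> /mx4_inj[[_ h01 h02 _] [h10 _ h12 h13] [h20 h21 _ h23] [_ h31 h32 _]].
have n1 := epsilon_neq1 R; have n2 := epsilon2_neq1 R; rewrite expr2 in h10 h12 h13.
have z01 : x01 = 0 by apply: (eq_mul_neq1 h01 _ n1); ring.
have z02 : x02 = 0 by apply: (eq_mul_neq1 h02 _ n2); ring.
have z10 : x10 = 0 by apply: (eq_mul_neq1 h10 _ n2); ring.
have z12 : x12 = 0.
  apply: (eq_mul_neq1 h12 _ n1); transitivity (e * e * e * e * x12); first ring.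
  by rewrite e3 mul1r.
have z13 : x13 = 0 by apply: (eq_mul_neq1 h13 _ n2); ring.
have z20 : x20 = 0 by apply: (eq_mul_neq1 h20 _ n1); ring.
have z21 : x21 = 0 by apply: (eq_mul_neq1 h21 _ n2); ring.
have z23 : x23 = 0 by apply: (eq_mul_neq1 h23 _ n1); ring.
have z31 : x31 = 0 by apply: (eq_mul_neq1 h31 _ n1); ring.
have z32 : x32 = 0 by apply: (eq_mul_neq1 h32 _ n2); ring.
exists x00, x11, x22, x33, x03, x30.
by rewrite z01 z02 z10 z12 z13 z20 z21 z23 z31 z32.
Qed.

Lemma fixed_sub_grpK : fixed_in (@grpG R) (@kappa R) `<=` @grpK R.
Proof.
move=> a [Ga ka]; have ua := grpG_unit Ga; move/grpGP: (Ga) => [da ba].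
(* Powers of [kappa] separate the two factors: the square fixes [a] under [sigma^2], hence under
   [sigma] as [sigma^3 = 1], and then [tau1] fixes [a] too. *)
have s2 : sigma (sigma a) = a := etrans (esym (kappa2 ua)) (etrans (congr1 (@kappa R) ka) ka).
have sa : sigma a = a := esym (etrans (esym (sigma3 a)) (congr1 (@sigma R) s2)).
have aJ : a *m J *m a^T = J.
  have st : sigma (tau1 a) = a := etrans (esym (kappa_sigma_tau1 ua)) ka.
  have := etrans (esym (sigma3 (tau1 a))) (etrans (congr1 (fun z => sigma (sigma z)) st) s2).
  rewrite /tau1 => h; rewrite -[X in X *m J]h -(mulmxA _ J J) mxJ_mul mulmx1.
  by rewrite mulmxKV// unitmx_tr.
have [p [x [y [t [r [s ea]]]]]] := sigma_fixed sa.
move: da ba aJ; rewrite ea det_mx4_block barE mx4_tr /mxJ1 !mx4M !(conjc0).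
move=> da /mx4_inj[[cp _ _ _] [_ cx _ _] [_ _ cy _] [_ _ _ _]].
move=> /mx4_inj[[h00 _ _ h03] [_ _ h12 _] [_ _ _ _] [h30 _ _ h33]].
have two (z : C) : 2 * z = 0 -> z = 0.
  by move=> /eqP; rewrite mulf_eq0 pnatr_eq0 => /eqP.
(* Preserving [J] makes the outer two by two block diagonal or antidiagonal. The antidiagonal case
   has determinant [-1], against [det a = 1]. *)
have pr : p * r = 0 by apply: two; rewrite -h00; ring.
have st : s * t = 0 by apply: two; rewrite -h33; ring.
have xy : x * y = 1 by rewrite -h12; ring.
have d : p * t - r * s = 1 by rewrite -[RHS]da xy mul1r.
have h : r * s + p * t = 1 by rewrite -h03; ring.
have rs : r * s = 0.
  apply: two; have -> : 2 * (r * s) = (r * s + p * t) - (p * t - r * s) by ring.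
  by rewrite h d subrr.
have pt : p * t = 1 by rewrite -[RHS]d rs subr0.
have [p0 t0] : p != 0 /\ t != 0.
  by split; apply: contra_eq_neq pt => ->; rewrite ?mul0r ?mulr0 eq_sym oner_neq0.
have r0 : r = 0 by move/eqP: pr; rewrite mulf_eq0 (negbTE p0) => /eqP.
have s0 : s = 0 by move/eqP: st; rewrite mulf_eq0 (negbTE t0) orbF => /eqP.
have x0 : x != 0 by apply: contra_eq_neq xy => ->; rewrite mul0r eq_sym oner_neq0.
have tp : t = p^-1 by apply: (mulfI p0); rewrite pt divff.
have yx : y = x^-1 by apply: (mulfI x0); rewrite xy divff.
apply/grpKP; exists p, x; split=> //; first by rewrite cy.
by rewrite /mxK r0 s0 tp yx.
Qed.

Lemma grpK_fixed : fixed_in (@grpG R) (@kappa R) = @grpK R.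
Proof. by apply/seteqP; split; [exact: fixed_sub_grpK|exact: grpK_sub_fixed]. Qed.

Lemma identity_component_sub (H : set 'M[C]_4) : identity_component H `<=` H.
Proof. by move=> a [c [_ Hc _ <-]]; apply: Hc; rewrite in_itv /= ler01 lexx. Qed.

(** The differential reflects the entries in the antidiagonal, up to sign and a power of [e]; all
    eigenspace computations are read off from this table. *)
Lemma dkappaE (a00 a01 a02 a03 a10 a11 a12 a13 a20 a21 a22 a23 a30 a31 a32 a33 : C) :
  dkappa (mx4 [:: [:: a00; a01; a02; a03]; [:: a10; a11; a12; a13];
                  [:: a20; a21; a22; a23]; [:: a30; a31; a32; a33]]) =
  - mx4 [:: [:: a33; e * a23; e * e * a13; a03];
            [:: e * e * a32; a22; e * a12; e * e * a02];
            [:: e * a31; e * e * a21; a11; e * a01];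
            [:: a30; e * a20; e * e * a10; a00]].
Proof.
rewrite /dkappa /sigma invmx_mxE /Defs.mxE /mxEc /mxJ1 expr2 !mx4M mx4_tr !mx4M; congr (- _).
have e33 x : x = e * e * e * x by rewrite e3 mul1r.
mx4_congr; try ring.
- rewrite [RHS]e33; ring.
- rewrite [RHS]e33; ring.
- rewrite [RHS]e33; ring.
Qed.

Lemma lieK_explicit X : lieK X <-> exists r t : C,
  [/\ conjc r = r, conjc t = - t & X =
  mx4 [:: [:: r; 0; 0; 0]; [:: 0; t; 0; 0]; [:: 0; 0; - t; 0]; [:: 0; 0; 0; - r]]].
Proof.
split; last first.
  move=> [r [t [cr ct ->]]]; split.
    apply/lieGP; rewrite mx4_trace barE !(conjc0, conjcN) cr ct opprK; split=> //.
    by ring.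
  by rewrite dkappaE mx4N !opprK !mulr0 !oppr0.
move=> [/lieGP[tX bX] kX]; move: tX bX kX.
rewrite (mx4_eta X).
move: (X o0 o0) (X o0 o1) (X o0 o2) (X o0 o3) => x00 x01 x02 x03.
move: (X o1 o0) (X o1 o1) (X o1 o2) (X o1 o3) => x10 x11 x12 x13.
move: (X o2 o0) (X o2 o1) (X o2 o2) (X o2 o3) => x20 x21 x22 x23.
move: (X o3 o0) (X o3 o1) (X o3 o2) (X o3 o3) => x30 x31 x32 x33.
rewrite mx4_trace barE dkappaE mx4N => tX.
move=> /mx4_inj[[c00 _ _ _] _ [_ _ c11 _] _].
move=> /mx4_inj[[h00 h01 h02 h03] [h10 h11 h12 h13] [h20 h21 h22 h23] [h30 h31 h32 h33]].
have n1 := epsilon_neq1 R; have n2 := epsilon2_neq1 R.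
have m1 : (-1 : C) != 1 by rewrite eq_sym -subr_eq0 opprK -[1 + 1]/(2%:R) pnatr_eq0.
have z01 : x01 = 0.
  apply: (eq_mul_neq1 h01 _ n2); rewrite -h23; ring.
have z02 : x02 = 0.
  apply: (eq_mul_neq1 h02 _ n1); rewrite -h13; transitivity (e * e * e * e * x02); first ring.
  by rewrite e3 mul1r.
have z03 : x03 = 0 by apply: (eq_mul_neq1 h03 _ m1); ring.
have z10 : x10 = 0.
  apply: (eq_mul_neq1 h10 _ n1); rewrite -h32; transitivity (e * e * e * e * x10); first ring.
  by rewrite e3 mul1r.
have z13 : x13 = 0 by rewrite -h13 z02; ring.
have z20 : x20 = 0.
  apply: (eq_mul_neq1 h20 _ n2); rewrite -h31; ring.
have z23 : x23 = 0 by rewrite -h23 z01; ring.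
have z30 : x30 = 0 by apply: (eq_mul_neq1 h30 _ m1); ring.
have z31 : x31 = 0 by rewrite -h31 z20; ring.
have z32 : x32 = 0 by rewrite -h32 z10; ring.
have z12 : x12 = 0 by apply: (eq_mul_neq1 h12 _ (Nepsilon_neq1 R)); ring.
have z21 : x21 = 0 by apply: (eq_mul_neq1 h21 _ (Nepsilon2_neq1 R)); ring.
exists x00, x11; split=> //; first by rewrite c11 -h22.
by rewrite -[x33]opprK h00 -[x22]opprK h11 z01 z02 z03 z10 z12 z13 z20 z21 z23 z30 z31 z32.
Qed.

Lemma lieK_ctr X : lieK X -> lieK (ctr X).
Proof.
move=> /lieK_explicit[r [t [cr ct ->]]]; apply/lieK_explicit; exists r, (- t).
by rewrite conjcN ct /ctr mx4_tr mx4_map !(conjc0, conjcN) cr ct.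
Qed.

(* The orthogonal complement of the isotropy algebra for the trace form. *)
Definition lieP : set 'M[C]_4 := [set X | [/\ lieG X, X o0 o0 = X o3 o3 & X o1 o1 = X o2 o2]].

Lemma lieP_ctr X : lieP X -> lieP (ctr X).
Proof.
by move=> [GX h1 h2]; split; [exact: lieG_ctr|rewrite !matrix.mxE h1|rewrite !matrix.mxE h2].
Qed.

Lemma barD X Y : bar (X + Y) = bar X + bar Y.
Proof. by rewrite /bar map_mxD mulmxDr mulmxDl. Qed.

Lemma barZ (c : C) X : bar (c *: X) = conjc c *: bar X.
Proof. by rewrite /bar map_mxZ -scalemxAr -scalemxAl. Qed.

Lemma lieG_lin (r : R) X Y : lieG X -> lieG Y -> lieG (r%:C *: X + Y).
Proof.
move=> /lieGP[tX bX] /lieGP[tY bY]; apply/lieGP.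
by rewrite mxtraceD mxtraceZ tX tY mulr0 addr0 barD barZ bX bY conjc_real.
Qed.

Lemma lieG0 : @lieG R 0.
Proof. by apply/lieGP; rewrite mxtrace0 /bar map_mx0 mulmx0 mul0mx. Qed.

Lemma lieP_real_subspace : real_subspace lieP.
Proof.
split; first by split; rewrite ?matrix.mxE//; exact: lieG0.
move=> r X Y [GX h1 h2] [GY h3 h4]; split; first exact: lieG_lin.
  by rewrite !matrix.mxE h1 h3.
by rewrite !matrix.mxE h2 h4.
Qed.

Lemma lieG_decomposition : @lieG R = [set X + Y | X in @lieK R & Y in lieP].
Proof.
apply/seteqP; split=> [X GX|_ [X KX [Y [GY _ _] <-]]]; last first.
  by rewrite -[X]scale1r; apply: (@lieG_lin 1) => //; case: KX.
(* These halves are the odd part of the diagonal under reflection, so subtracting [Z] equalizes the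
   entries 0, 3 and 1, 2. *)
pose r : C := (X o0 o0 - X o3 o3) / 2; pose t : C := (X o1 o1 - X o2 o2) / 2.
pose Z := mx4 [:: [:: r; 0; 0; 0]; [:: 0; t; 0; 0]; [:: 0; 0; - t; 0]; [:: 0; 0; 0; - r]].
have c2 : conjc (2^-1 : C) = 2^-1 by rewrite conjc_inv conjc_nat.
have KZ : lieK Z.
  apply/lieK_explicit; exists r, t; split=> //.
    move: GX => /lieGP[_]; rewrite (mx4_eta X) barE => /mx4_inj[[c0 _ _ _] _ _ [_ _ _ c3]].
    by rewrite /r conjcM c2 (rmorphB (@conjc R)) /= c0 c3.
  move: GX => /lieGP[_]; rewrite (mx4_eta X) barE => /mx4_inj[_ [_ c1 _ _] [_ _ c2' _] _].
  by rewrite /t conjcM c2 (rmorphB (@conjc R)) /= c1 c2'; ring.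
exists Z => //; exists (X - Z); last by rewrite addrC subrK.
split.
- rewrite addrC -scaleN1r; have -> : (-1 : C) = (-1)%:C by rewrite rmorphN1.
  by apply: lieG_lin => //; case: KZ.
- by rewrite !matrix.mxE /= /r; field.
- by rewrite !matrix.mxE /= /t; field.
Qed.

Lemma lieK_lieP_trivial : @lieK R `&` lieP = [set 0].
Proof.
apply/seteqP; split=> [X [/lieK_explicit[r [t [_ _ ->]]] [_]]|_ ->].
  rewrite !matrix.mxE /= => /eqP; rewrite -addr_eq0 -mulr2n mulrn_eq0 /= => /eqP ->.
  move=> /eqP; rewrite -addr_eq0 -mulr2n mulrn_eq0 /= => /eqP ->.
  by rewrite oppr0 mx4_0.
split; last by split; rewrite ?matrix.mxE//; exact: lieG0.
apply/lieK_explicit; exists 0, 0; rewrite !conjc0 !oppr0 mx4_0; split=> //.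
Qed.

(** Conjugation by a diagonal matrix leaves the diagonal of [X] unchanged, and the complement is cut
    out by conditions on the diagonal. *)
Lemma lieP_Ad a X : grpK a -> lieP X -> lieP (a *m X *m invmx a).
Proof.
move=> Ka [GX h1 h2]; have [Ga _] := grpK_sub_fixed Ka; have ua := grpG_unit Ga.
split.
- apply/lieGP; move: GX => /lieGP[tX bX].
  rewrite mxtrace_mulC mulmxA (mulVmx ua) mul1mx tX !barM bX (bar_invmx ua).
  by move: Ga => /grpGP[_ ->].
- move: Ka => /grpKP[k1 [k2 [_ k10 _ k20 ->]]].
  rewrite invmx_mxK// (mx4_eta X) /mxK !mx4M !matrix.mxE /=.
  by rewrite h1; field.
- move: Ka => /grpKP[k1 [k2 [_ k10 _ k20 ->]]].
  rewrite invmx_mxK// (mx4_eta X) /mxK !mx4M !matrix.mxE /=.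
  by rewrite h2; field.
Qed.

(** All three nondegeneracy conditions follow from stability under conjugate transposition. The
    fixed group equals [K], so the condition on its identity component is immediate. *)
Lemma regular_SL4 : regular_symmetric_space 6 (@grpG R) (@lieG R) (@grpK R) (@lieK R)
  (@kappa R) (@dkappa R).
Proof.
have trG X : lieG X -> \tr X = 0 by move=> /lieGP[].
split.
- by [].
- by apply: killing_nondegenerate; [exact: trG|move=> X; exact: lieG_ctr].
- exact: set_bij_kappa.
- by move=> a c Ga Gc; apply: kappaM; exact: grpG_unit.
- exact: order_kappa.
- exact: grpK_group.
- exact: grpK_sub_fixed.
- rewrite grpK_fixed; exact: identity_component_sub.
- reflexivity.
- exists lieP; split.
  + exact: lieP_real_subspace.
  + exact: lieG_decomposition.
  + exact: lieK_lieP_trivial.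
  + exact: lieP_Ad.
  + by apply: killing_nondegenerate => X; [move=> [/trG]|exact: lieP_ctr].
- by apply: killing_nondegenerate => X; [move=> [/trG]|exact: lieK_ctr].
Qed.

End SymmetricSpace.

(** * The signature of the symmetric matrices in the orbit *)

Section Quadric.
Context (R : realType).
Local Notation C := R[i].

Lemma char_poly_conj n (P D : 'M[C]_n) : P \in unitmx ->
  char_poly (invmx P *m D *m P) = char_poly D.
Proof.
move=> uP; rewrite /char_poly.
pose p (M : 'M[C]_n) := map_mx polyC M.
have pM (M N : 'M[C]_n) : p (M *m N) = p M *m p N by exact: map_mxM.
have p1 : p (invmx P) *m p P = 1%:M by rewrite -pM mulVmx// /p map_scalar_mx.
have -> : char_poly_mx (invmx P *m D *m P) = p (invmx P) *m char_poly_mx D *m p P.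
  rewrite /char_poly_mx -!/(p _) !pM mulmxBr mulmxBl; congr (_ - _).
  by rewrite mul_mx_scalar -scalemxAl p1 scalemx1.
rewrite !det_mulmx mulrAC -det_mulmx p1 det1 mul1r.
by [].
Qed.

Lemma row_norm_eq0 n (x : 'rV[C]_n) : (x *m ctr x) 0 0 <= 0 -> x = 0.
Proof.
have E : (x *m ctr x) 0 0 = \sum_j `|x 0 j| ^+ 2.
  rewrite matrix.mxE; apply: eq_bigr => j _; rewrite !matrix.mxE.
  by rewrite normCK.
rewrite E => le0; have : \sum_j `|x 0 j| ^+ 2 == 0.
  by rewrite eq_le le0 sumr_ge0// => j _; rewrite exprn_ge0.
rewrite psumr_eq0; last by move=> k _; rewrite exprn_ge0.
move=> /allP h; apply/matrixP => i j; rewrite ord1 matrix.mxE.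
by have := h j (mem_index_enum j); rewrite /= expf_eq0 normr_eq0 => /eqP.
Qed.

Lemma ctr_cplx m n (A : 'M[R]_(m, n)) : ctr (cplx A) = cplx A^T.
Proof. by apply/matrixP => i j; rewrite !matrix.mxE conjc_real. Qed.

Lemma cplxM m n p (A : 'M[R]_(m, n)) (B : 'M[R]_(n, p)) : cplx (A *m B) = cplx A *m cplx B.
Proof. exact: map_mxM. Qed.

(** The complex spectral theorem for the Hermitian matrix [cplx A] gives real eigenvalues; the
    factorization of the characteristic polynomial descends because the embedding of polynomials is
    injective. *)
Lemma spectral_real_symmetric n (A : 'M[R]_n) : A^T = A ->
  exists (P : 'M[C]_n) (d : 'I_n -> R),
    [/\ P *m ctr P = 1%:M, cplx A = ctr P *m diag_mx (\row_i (d i)%:C) *m P &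
        char_poly A = \prod_i ('X - (d i)%:P)].
Proof.
move=> sA.
have Aherm : cplx A \is hermsymmx.
  by apply/is_hermitianmxP; rewrite expr0 scale1r -[RHS]/(ctr (cplx A)) ctr_cplx sA.
have Adiag := orthomx_spectralP (hermitian_normalmx Aherm).
have /mxOverP dreal := hermitian_spectral_diag_real Aherm.
set P := spectralmx (cplx A) in Adiag; set s := spectral_diag (cplx A) in Adiag dreal.
have uP : P \is unitarymx := spectral_unitarymx _.
have sE : s = \row_i (complex.Re (s 0 i))%:C.
  by apply/rowP => i; rewrite matrix.mxE; apply/esym/RRe_real/dreal.
have PP : P *m ctr P = 1%:M by exact/unitarymxP.
have iP : invmx P = ctr P := invmx_uniq PP.
exists P, (fun i => complex.Re (s 0 i)); split; [exact: PP|by rewrite -sE -iP|].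
apply: (map_poly_inj (real_complex R)); rewrite map_char_poly.
have -> : map_mx (real_complex R) A = invmx P *m diag_mx s *m P by rewrite -Adiag.
rewrite char_poly_conj; last exact: unitarymx_unit.
rewrite char_poly_trig; last exact/diag_mx_is_trig.
rewrite rmorph_prod /=; apply: eq_bigr => i _.
rewrite rmorphB /= map_polyX map_polyC /= matrix.mxE eqxx mulr1n {1}sE matrix.mxE.
by [].
Qed.

(* On the hyperplane orthogonal to [w] the Hermitian form of [B B^T - w w^T] is
   [|x B|^2], hence it is positive definite there and [A] has at most one
   nonpositive eigenvalue. *)
Lemma nonpos_eigenvalue_unique n (A B : 'M[R]_n) (w : 'cV[R]_n)
    (P : 'M[C]_n) (d : 'I_n -> R) i j :
  \det B != 0 -> A = B *m B^T - w *m w^T ->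
  P *m ctr P = 1%:M -> cplx A = ctr P *m diag_mx (\row_i (d i)%:C) *m P ->
  d i <= 0 -> d j <= 0 -> i = j.
Proof.
move=> dB eA PP eD di dj; apply/eqP; apply: contraT => ij.
pose v := P *m cplx w.
(* Two eigenvectors span a plane, and orthogonality to [w] is one linear condition on it, so a
   nonzero combination [x] satisfies it. *)
have [a [b [ab abv]]] : exists a b : C, (a != 0) || (b != 0) /\ a * v i 0 + b * v j 0 = 0.
  have [v0|v0] := eqVneq (v i 0) 0.
    by exists 1, 0; rewrite oner_eq0 v0 mulr0 mul0r addr0.
  by exists (v j 0), (- v i 0); rewrite oppr_eq0 v0 orbT; split=> //; ring.
pose c : 'rV[C]_n := \row_k (if k == i then a else if k == j then b else 0).
pose x := c *m P.
have xw : x *m cplx w = 0.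
  have ci : c 0 i = a by rewrite matrix.mxE eqxx.
  have cj : c 0 j = b by rewrite matrix.mxE eqxx eq_sym (negbTE ij).
  have ck k : k != i -> k != j -> c 0 k = 0.
    by move=> /negbTE ki /negbTE kj; rewrite matrix.mxE ki kj.
  apply/matrixP => p q; rewrite !ord1 [RHS]matrix.mxE /x -mulmxA -/v matrix.mxE.
  rewrite (bigD1 i)//= (bigD1 j)/=; last by rewrite eq_sym.
  rewrite ci cj addrA abv add0r big1// => k /andP[ki kj].
  by rewrite ck// mul0r.
have PP' : ctr P *m P = 1%:M by exact: mulmx1C.
have le0 : (x *m cplx A *m ctr x) 0 0 <= 0.
  rewrite /x eD ctrM !mulmxA -(mulmxA c P) PP mulmx1.
  rewrite -(mulmxA _ P (ctr P)) PP mulmx1 matrix.mxE sumr_le0// => k _.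
  rewrite mul_mx_diag !matrix.mxE mulrAC -[X in _ * X * _]/(Num.conj _) -normCK.
  case: (k =P i) => [->|_]; first by rewrite mulr_ge0_le0 ?exprn_ge0// lecR.
  case: (k =P j) => [->|_]; first by rewrite mulr_ge0_le0 ?exprn_ge0// lecR.
  by rewrite normr0 expr0n mul0r.
have xB : x *m cplx B = 0.
  apply: row_norm_eq0; apply: le_trans le0.
  have -> : cplx A = cplx B *m cplx B^T - cplx w *m cplx w^T.
    by rewrite eA -!cplxM; apply/matrixP => p q; rewrite !matrix.mxE rmorphB.
  by rewrite mulmxBr (mulmxA x (cplx w)) xw mul0mx subr0 ctrM ctr_cplx !mulmxA.
have uB : cplx B \in unitmx.
  by rewrite unitmxE unitfE det_map_mx fmorph_eq0.
have x0 : x = 0 by rewrite -[x](mulmxK uB) xB mul0mx.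
have c0 : c = 0 by rewrite -[c]mulmx1 -PP mulmxA -/x x0 mul0mx.
have ca : a = 0 by move/rowP/(_ i): c0; rewrite !matrix.mxE eqxx.
have cb : b = 0 by move/rowP/(_ j): c0; rewrite !matrix.mxE eqxx eq_sym (negbTE ij).
by rewrite ca cb eqxx in ab.
Qed.

(** With [w0 = e_0 - e_3], [hatJ1] is [1 - w0 w0^T], so the matrix is [B B^T] minus a rank-one
    square and has at most one nonpositive eigenvalue. Determinant [-1] forces one negative
    eigenvalue, and the others are then positive. *)
Lemma quadrics_orbit (B : 'M[R]_4) : \det B = 1 ->
  quadrics (cplx B *m hatJ1 R *m (cplx B)^T).
Proof.
move=> dB.
pose w0 : 'cV[R]_4 := \col_i (if (i : nat) is 0%N then 1 else if (i : nat) is 3%N then -1 else 0).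
pose hJ : 'M[R]_4 := 1%:M - w0 *m w0^T.
have hJE : cplx hJ = hatJ1 R.
  rewrite hatJ1E; apply/matrixP; do 2![apply: ord4P];
  rewrite !matrix.mxE big_ord1 !matrix.mxE /=; apply/eqP;
  rewrite eq_complex /= ?eqxx ?andbT; apply/eqP; ring.
pose A := B *m hJ *m B^T.
have eA : A = B *m B^T - (B *m w0) *m (B *m w0)^T.
  by rewrite /A /hJ mulmxBr mulmx1 mulmxBl trmx_mul !mulmxA.
have sA : A^T = A by rewrite eA linearB /= !trmx_mul !trmxK.
have dA : \det A = -1.
  rewrite /A !det_mulmx det_tr dB mulr1 mul1r; apply: (@complexI R).
  rewrite -det_map_mx -[map_mx _ _]/(cplx hJ) hJE hatJ1E det_mx4_block.
  by rewrite rmorphN1; ring.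
have [P [d [PP eD cA]]] := spectral_real_symmetric sA.
have dB0 : \det B != 0 by rewrite dB oner_eq0.
have uniq i j : d i <= 0 -> d j <= 0 -> i = j.
  exact: (nonpos_eigenvalue_unique dB0 eA PP eD).
have dprod : \prod_i d i = -1.
  have := char_poly_det A; rewrite -horner_coef0 cA horner_prod dA.
  under eq_bigr do rewrite hornerXsubC sub0r -mulN1r.
  rewrite big_split /= prodr_const card_ord; apply: mulfI.
  by rewrite expf_neq0// oppr_eq0 oner_eq0.
have [i di] : exists i, d i < 0.
  apply/existsP; apply: contraT; rewrite negb_exists => /forallP h.
  have : 0 <= \prod_i d i by apply: prodr_ge0 => i _; rewrite leNgt.
  by rewrite dprod oppr_ge0 ler10.
have dpos j : j != i -> 0 < d j.
  by move=> ji; rewrite ltNge; apply: contra ji => dj; apply/eqP/uniq => //; exact: ltW.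
exists A; split=> //.
  by rewrite /A !cplxM hJE map_trmx.
have {}cA : char_poly A =
    ('X - (d o0)%:P) * (('X - (d o1)%:P) * (('X - (d o2)%:P) * ('X - (d o3)%:P))).
  rewrite cA !big_ord_recl big_ord0 mulr1.
  by congr (('X - (d _)%:P) * (('X - (d _)%:P) * (('X - (d _)%:P) * ('X - (d _)%:P))));
    apply: val_inj.
move: i di dpos; apply: ord4P => di dpos.
- exists (d o1), (d o2), (d o3), (d o0); split; rewrite ?dpos// cA !big_cons big_nil; ring.
- exists (d o0), (d o2), (d o3), (d o1); split; rewrite ?dpos// cA !big_cons big_nil; ring.
- exists (d o0), (d o1), (d o3), (d o2); split; rewrite ?dpos// cA !big_cons big_nil; ring.
- exists (d o0), (d o1), (d o2), (d o3); split; rewrite ?dpos// cA !big_cons big_nil; ring.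
Qed.

End Quadric.

(** * Derivatives in z and its conjugate *)

Section Wirtinger.
Context (R : realType).
Local Notation C := R[i].
Implicit Types (D : set (R * R)) (q : R * R).

Lemma dzmE m n (A : R * R -> 'M[C]_(m, n)) q :
  dzm A q = 2^-1 *: (cpdm 0 A q - ci R *: cpdm 1 A q).
Proof. by apply/matrixP => i j; rewrite !matrix.mxE /dz mulrC. Qed.

Lemma dzbmE m n (A : R * R -> 'M[C]_(m, n)) q :
  dzbm A q = 2^-1 *: (cpdm 0 A q + ci R *: cpdm 1 A q).
Proof. by apply/matrixP => i j; rewrite !matrix.mxE /dzb mulrC. Qed.

Lemma ci2 : ci R * ci R = -1.
Proof. by rewrite -expr2 sqr_i. Qed.

Lemma cpdm0E m n (A : R * R -> 'M[C]_(m, n)) q : cpdm 0 A q = dzm A q + dzbm A q.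
Proof.
rewrite dzmE dzbmE; move: (cpdm 0 A q) (cpdm 1 A q) => X Y.
by apply/matrixP => i j; rewrite !matrix.mxE; field.
Qed.

Lemma cpdm1E m n (A : R * R -> 'M[C]_(m, n)) q :
  cpdm 1 A q = ci R *: (dzm A q - dzbm A q).
Proof.
rewrite dzmE dzbmE; move: (cpdm 0 A q) (cpdm 1 A q) => X Y.
apply/matrixP => i j; rewrite !matrix.mxE.
have -> : ci R * (2^-1 * (X i j - ci R * Y i j) - 2^-1 * (X i j + ci R * Y i j)) =
   - (ci R * ci R) * Y i j by field.
by rewrite ci2 opprK mul1r.
Qed.

Lemma smoothcmZ D m n (c : C) (A : R * R -> 'M[C]_(m, n)) : open D ->
  smoothcm D A -> smoothcm D (fun w => c *: A w).
Proof.
move=> oD sA i j; under eq_fun do rewrite matrix.mxE.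
by apply: smoothcM => //; exact: smoothc_cst.
Qed.

Lemma smoothcm_dzm D m n (A : R * R -> 'M[C]_(m, n)) : open D ->
  smoothcm D A -> smoothcm D (dzm A).
Proof.
move=> oD sA; have -> : dzm A = fun w => 2^-1 *: (cpdm 0 A w + - ci R *: cpdm 1 A w).
  by apply/funext => w; rewrite dzmE scaleNr.
by apply: smoothcmZ => //; apply: smoothcmD => //; [|apply: smoothcmZ => //]; exact: smoothcm_cpd.
Qed.

Lemma smoothcm_dzbm D m n (A : R * R -> 'M[C]_(m, n)) : open D ->
  smoothcm D A -> smoothcm D (dzbm A).
Proof.
move=> oD sA; have -> : dzbm A = fun w => 2^-1 *: (cpdm 0 A w + ci R *: cpdm 1 A w).
  by apply/funext => w; rewrite dzbmE.
by apply: smoothcmZ => //; apply: smoothcmD => //; [|apply: smoothcmZ => //]; exact: smoothcm_cpd.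
Qed.

Lemma cpdmZ D m n k (c : C) (A : R * R -> 'M[C]_(m, n)) q : open D -> D q ->
  smoothcm D A -> cpdm k (fun w => c *: A w) q = c *: cpdm k A q.
Proof.
move=> oD Dq sA; apply/matrixP => i j; rewrite !matrix.mxE.
under eq_fun do rewrite matrix.mxE.
by rewrite (cpdM k oD (smoothc_cst _ _) (sA i j) Dq) cpd_cst mul0r add0r.
Qed.

Lemma dzmM D m n p (A : R * R -> 'M[C]_(m, n)) (B : R * R -> 'M[C]_(n, p)) q :
  open D -> smoothcm D A -> smoothcm D B -> D q ->
  dzm (fun w => A w *m B w) q = dzm A q *m B q + A q *m dzm B q.
Proof.
move=> oD sA sB Dq; rewrite !dzmE !(cpdmM _ oD sA sB Dq).
rewrite -scalemxAl -scalemxAr mulmxBl mulmxBr -scalemxAl -scalemxAr.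
by rewrite -[RHS]scalerDr; congr (_ *: _); rewrite scalerDr opprD addrACA.
Qed.

Lemma dzbmM D m n p (A : R * R -> 'M[C]_(m, n)) (B : R * R -> 'M[C]_(n, p)) q :
  open D -> smoothcm D A -> smoothcm D B -> D q ->
  dzbm (fun w => A w *m B w) q = dzbm A q *m B q + A q *m dzbm B q.
Proof.
move=> oD sA sB Dq; rewrite !dzbmE !(cpdmM _ oD sA sB Dq).
rewrite -scalemxAl -scalemxAr mulmxDl mulmxDr -scalemxAl -scalemxAr.
by rewrite -[RHS]scalerDr; congr (_ *: _); rewrite scalerDr addrACA.
Qed.

Lemma eq_dzm D m n (A B : R * R -> 'M[C]_(m, n)) q :
  open D -> D q -> {in D, A =1 B} -> dzm A q = dzm B q.
Proof. by move=> oD Dq AB; rewrite !dzmE !(eq_cpdm _ oD Dq AB). Qed.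

Lemma eq_dzbm D m n (A B : R * R -> 'M[C]_(m, n)) q :
  open D -> D q -> {in D, A =1 B} -> dzbm A q = dzbm B q.
Proof. by move=> oD Dq AB; rewrite !dzbmE !(eq_cpdm _ oD Dq AB). Qed.

Lemma dzm_cst m n (A : 'M[C]_(m, n)) q : dzm (fun=> A) q = 0.
Proof. by rewrite dzmE !cpdm_cst scaler0 subr0 scaler0. Qed.

Section Entries.
Variables (f00 f01 f02 f03 f10 f11 f12 f13 f20 f21 f22 f23 f30 f31 f32 f33 : R * R -> C).
Let A w := mx4 [:: [:: f00 w; f01 w; f02 w; f03 w]; [:: f10 w; f11 w; f12 w; f13 w];
                   [:: f20 w; f21 w; f22 w; f23 w]; [:: f30 w; f31 w; f32 w; f33 w]].

Lemma dzm_mx4 q : dzm A q = mx4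
  [:: [:: dz f00 q; dz f01 q; dz f02 q; dz f03 q];
      [:: dz f10 q; dz f11 q; dz f12 q; dz f13 q];
      [:: dz f20 q; dz f21 q; dz f22 q; dz f23 q];
      [:: dz f30 q; dz f31 q; dz f32 q; dz f33 q]].
Proof.
by apply/matrixP; do 2![apply: ord4P]; rewrite [LHS]matrix.mxE [RHS]matrix.mxE /=;
  congr (dz _ q); apply/funext => w; rewrite /A matrix.mxE.
Qed.

Lemma dzbm_mx4 q : dzbm A q = mx4
  [:: [:: dzb f00 q; dzb f01 q; dzb f02 q; dzb f03 q];
      [:: dzb f10 q; dzb f11 q; dzb f12 q; dzb f13 q];
      [:: dzb f20 q; dzb f21 q; dzb f22 q; dzb f23 q];
      [:: dzb f30 q; dzb f31 q; dzb f32 q; dzb f33 q]].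
Proof.
by apply/matrixP; do 2![apply: ord4P]; rewrite [LHS]matrix.mxE [RHS]matrix.mxE /=;
  congr (dzb _ q); apply/funext => w; rewrite /A matrix.mxE.
Qed.

End Entries.

Lemma dzmT m n (A : R * R -> 'M[C]_(m, n)) q : dzm (fun w => (A w)^T) q = (dzm A q)^T.
Proof.
apply/matrixP => i j; rewrite !matrix.mxE; congr (dz _ q).
by apply/funext => w; rewrite matrix.mxE.
Qed.

(** Both sides expand to the same combination of real second derivatives once the mixed ones are
    identified; this is the source of the integrability condition. *)
Lemma dzmC D m n (A : R * R -> 'M[C]_(m, n)) q : open D -> D q -> smoothcm D A ->
  dzbm (dzm A) q = dzm (dzbm A) q.
Proof.
move=> oD Dq sA.
have sk k := smoothcm_cpd k sA.
have sZ (c : C) := smoothcmZ c oD (sk 1).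
have e1 : dzm A = fun w => 2^-1 *: (cpdm 0 A w + - ci R *: cpdm 1 A w).
  by apply/funext => w; rewrite dzmE scaleNr.
have e2 : dzbm A = fun w => 2^-1 *: (cpdm 0 A w + ci R *: cpdm 1 A w).
  by apply/funext => w; rewrite dzbmE.
have d k (c : C) : cpdm k (fun w => 2^-1 *: (cpdm 0 A w + c *: cpdm 1 A w)) q =
    2^-1 *: (cpdm k (cpdm 0 A) q + c *: cpdm k (cpdm 1 A) q).
  rewrite (cpdmZ _ _ oD Dq); last by apply: smoothcmD.
  by rewrite (cpdmD k (sk 0) (sZ c) Dq) (cpdmZ _ _ oD Dq (sk 1)).
have E1 : dzbm (dzm A) q = 2^-1 *:
    (2^-1 *: (cpdm 0 (cpdm 0 A) q + - ci R *: cpdm 0 (cpdm 1 A) q) +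
     ci R *: (2^-1 *: (cpdm 1 (cpdm 0 A) q + - ci R *: cpdm 1 (cpdm 1 A) q))).
  by rewrite (dzbmE (dzm A)) e1 (d 0 (- ci R)) (d 1 (- ci R)).
have E2 : dzm (dzbm A) q = 2^-1 *:
    (2^-1 *: (cpdm 0 (cpdm 0 A) q + ci R *: cpdm 0 (cpdm 1 A) q) -
     ci R *: (2^-1 *: (cpdm 1 (cpdm 0 A) q + ci R *: cpdm 1 (cpdm 1 A) q))).
  by rewrite (dzmE (dzbm A)) e2 (d 0 (ci R)) (d 1 (ci R)).
rewrite E1 E2 (cpdmC 1 0 oD sA Dq).
move: (cpdm 0 (cpdm 0 A) q) (cpdm 0 (cpdm 1 A) q) (cpdm 1 (cpdm 1 A) q) => X Y Z.
apply/matrixP => i j; rewrite !matrix.mxE; ring.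
Qed.

Lemma dz_conj D (u : R * R -> C) q : smoothc D u -> D q ->
  dz (fun w => conjc (u w)) q = conjc (dzb u q).
Proof.
move=> su Dq; rewrite /dz /dzb !(cpd_conj _ su Dq).
have c2 : conjc (2^-1 : C) = 2^-1 by rewrite conjc_inv conjc_nat.
have cci : conjc (ci R) = - ci R by apply/eqP; rewrite eq_complex /= oppr0 !eqxx.
by rewrite conjcM c2 conjcD conjcM cci mulNr.
Qed.

Lemma conj_log_deriv (x y : C) : conjc (conjc x / (2 * conjc y)) = x / (2 * y).
Proof. by rewrite conjcM conjc_inv conjcM !conjcK conjc_nat. Qed.

End Wirtinger.

(** * Algebraic identities behind harmonicity, conformality and primitivity *)

Section Refl.
Context (R : realType).
Local Notation C := R[i].
Local Notation J := (mxJ1 R).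
Implicit Types M : 'M[C]_4.

(* The differential of tau1 is [- refl]. *)
Definition refl M : 'M[C]_4 := J *m M^T *m J.

Lemma reflE (a00 a01 a02 a03 a10 a11 a12 a13 a20 a21 a22 a23 a30 a31 a32 a33 : C) :
  refl (mx4 [:: [:: a00; a01; a02; a03]; [:: a10; a11; a12; a13];
                [:: a20; a21; a22; a23]; [:: a30; a31; a32; a33]]) =
  mx4 [:: [:: a33; a23; a13; a03]; [:: a32; a22; a12; a02];
          [:: a31; a21; a11; a01]; [:: a30; a20; a10; a00]].
Proof. rewrite /refl /mxJ1 mx4_tr !mx4M; mx4_congr; ring. Qed.

Lemma refl_J M : J *m M^T = refl M *m J.
Proof. by rewrite /refl -mulmxA mxJ_mul mulmx1. Qed.

Lemma reflD M N : refl (M + N) = refl M + refl N.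
Proof. by rewrite /refl linearD /= mulmxDr mulmxDl. Qed.

Lemma reflZ (c : C) M : refl (c *: M) = c *: refl M.
Proof. by rewrite /refl linearZ /= -scalemxAr -scalemxAl. Qed.

(** Applied with [c = i] to [U - V]: the y-direction contributes its commutator with a minus
    sign. *)
Lemma refl_bracketZ (c : C) M : c * c = -1 ->
  (c *: M) *m refl (c *: M) - refl (c *: M) *m (c *: M) = - (M *m refl M - refl M *m M).
Proof.
move=> cc; rewrite reflZ -!scalemxAl -!scalemxAr !scalerA cc -scalerBr.
by rewrite scaleN1r.
Qed.

(** If [M] is the logarithmic derivative of the frame, [w] is the derivative of the Gauss map pulled
    back by the frame, and [- w J w] is the Christoffel term. The squares of [M] and of its
    reflection cancel, leaving a commutator. *)
Lemma second_fundamental_form M : let w := M *m J + J *m M^T in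
  M *m w + w *m M^T - w *m J *m w = (M *m refl M - refl M *m M) *m J.
Proof.
move=> w; have JJ := mxJ_mul R.
have wE : w = (M + refl M) *m J by rewrite /w refl_J mulmxDl.
have wJw : w *m J *m w = (M + refl M) *m (M + refl M) *m J.
  by rewrite wE -(mulmxA (M + refl M) J J) JJ mulmx1 mulmxA.
have wM : w *m M^T = (M + refl M) *m refl M *m J by rewrite wE -mulmxA refl_J mulmxA.
rewrite wJw wM wE mulmxA -mulmxDl -mulmxBl; congr (_ *m J).
rewrite !mulmxDr !mulmxDl.
move: (M *m M) (M *m refl M) (refl M *m M) (refl M *m refl M) => X Y Z T.
by apply/matrixP => i j; rewrite !matrix.mxE; ring.
Qed.

(* The matrices U and V for P = 0, with [a] standing for the logarithmic
   derivative in U; [mxV0] is applied to the conjugates of a, k and b. *)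
Definition mxU0 (a k b : C) : 'M[C]_4 :=
  mx4 [:: [:: a; 0; k; 0]; [:: 1; - a; 0; k]; [:: 0; b; a; 0]; [:: 0; 0; 1; - a]].

Definition mxV0 (a k b : C) : 'M[C]_4 :=
  mx4 [:: [:: a; k; 0; 0]; [:: 0; a; b; 0]; [:: 1; 0; - a; k]; [:: 0; 1; 0; - a]].

(** The matrix [s] is [U_zb + V_z] with the derivatives of [k] and [b] substituted. The unknowns [x]
    and [y] enter through a diagonal that [refl] negates, so they disappear from [s + refl s]. *)
Lemma divergence_identity (a a' k k' b b' x y : C) :
  let u := mxU0 a k b in let v := mxV0 a' k' b' in let m := u + v in let n := u - v in
  let s := mx4
    [:: [:: x + y; - (2 * a * k'); - (2 * a' * k); 0];
        [:: 0; - x + y; 2 * a * b'; - (2 * a' * k)];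
        [:: 0; 2 * a' * b; x - y; - (2 * a * k')];
        [:: 0; 0; 0; - x - y]] in
  (m *m refl m - refl m *m m) - (n *m refl n - refl n *m n) + 2 *: (s + refl s) = 0.
Proof.
move=> u v m n s; rewrite /m /n /u /v /s /mxU0 /mxV0 !(mx4N, mx4D, reflE, mx4Z, mx4M) -mx4_0.
mx4_congr; ring.
Qed.

(** The diagonal of [mxU0] is odd under [refl] and the rest is even, so [w J] is twice the component
    in the eigenspace of index [-1]. The trace form is invariant under the automorphism, so it
    vanishes on that eigenspace. *)
Lemma conformality_identity (a k b : C) :
  let w := mxU0 a k b *m J + J *m (mxU0 a k b)^T in \tr (w *m J *m w *m J) = 0.
Proof.
move=> w; have wJ : w *m J = mxU0 a k b + refl (mxU0 a k b).
  by rewrite /w refl_J -mulmxDl -mulmxA mxJ_mul mulmx1.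
rewrite -mulmxA wJ /mxU0 reflE mx4D mx4M mx4_trace; ring.
Qed.

Lemma gC_m1 (k b : C) : gC (-1) (mx4
  [:: [:: 0; 0; k; 0]; [:: 1; 0; 0; k]; [:: 0; b; 0; 0]; [:: 0; 0; 1; 0]]).
Proof.
split; first by rewrite mx4_trace; ring.
(* In ['Z_6] the index [-1] is represented by 5, and [omega ^ 5 = - e ^ 5 = - e ^ 2]. *)
have -> : omega R ^+ nat_of_ord (-1 : 'Z_6)%R = - (epsilon R * epsilon R).
  have -> : nat_of_ord (-1 : 'Z_6)%R = 5%N by [].
  rewrite /omega; transitivity (- (epsilon R * epsilon R * epsilon R) * (epsilon R * epsilon R)).
    by rewrite !exprS expr0; ring.
  by rewrite epsilon3 mulN1r.
rewrite dkappaE mx4N mx4Z; mx4_congr; ring.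
Qed.

Lemma gC_0 (a : C) : gC 0 (mx4
  [:: [:: a; 0; 0; 0]; [:: 0; - a; 0; 0]; [:: 0; 0; a; 0]; [:: 0; 0; 0; - a]]).
Proof.
split; first by rewrite mx4_trace; ring.
rewrite expr0 scale1r dkappaE mx4N; mx4_congr; ring.
Qed.

End Refl.

(** * The frame of a Demoulin surface and its Gauss map *)

Section DemoulinFrame.
Context (R : realType) (D : set (R * R)) (a k b : R * R -> R[i]) (zs : R * R)
  (F : R * R -> 'M[R[i]]_4).
Local Notation C := R[i].
Local Notation L := (mxL R).
Local Notation J := (mxJ1 R).

Let U q := mxU0 (a q) (k q) (b q).
Let V q := mxV0 (conjc (a q)) (conjc (k q)) (conjc (b q)).

Hypothesis oD : open D.
Hypothesis cD : connected D.
Hypothesis Dzs : D zs.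
Hypothesis sF : smoothcm D F.
Hypothesis Fzs : F zs = 1%:M.
Hypothesis Fz : forall q, D q -> dzm F q = F q *m U q.
Hypothesis Fzb : forall q, D q -> dzbm F q = F q *m V q.
Hypothesis bzb : forall q, D q -> dzb b q = 2 * conjc (a q) * b q.

(** The logarithmic derivatives of the frame in the two real directions; unlike [U] and [V]
    separately, they are fixed by [bar]. *)
Let A (i : 'I_2) q := if i == 0 then U q + V q else ci R *: (U q - V q).

Lemma frame_deriv i q : D q -> cpdm i F q = F q *m A i q.
Proof.
move=> Dq; rewrite /A; case: i => [[|[|//]] Hi].
  have -> : Ordinal Hi = 0 by apply: val_inj.
  by rewrite eqxx cpdm0E (Fz Dq) (Fzb Dq) mulmxDr.
have -> : Ordinal Hi = 1 by apply: val_inj.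
by rewrite /= cpdm1E (Fz Dq) (Fzb Dq) -mulmxBr scalemxAr.
Qed.

Lemma trace_A i q : \tr (A i q) = 0.
Proof.
have tU : \tr (U q) = 0 by rewrite mx4_trace; ring.
have tV : \tr (V q) = 0 by rewrite mx4_trace; ring.
rewrite /A; case: ifP => _; first by rewrite mxtraceD tU tV addr0.
by rewrite mxtraceZ raddfB /= tU tV subr0 mulr0.
Qed.

Lemma bar_U q : bar (U q) = V q.
Proof. by rewrite /U /V barE !(conjc0, conjc1, conjcN). Qed.

Lemma barK (X : 'M[C]_4) : bar (bar X) = X.
Proof.
rewrite (mx4_eta X) !barE !conjcK.
by [].
Qed.

Lemma bar_A i q : bar (A i q) = A i q.
Proof.
have bV : bar (V q) = U q by rewrite -bar_U barK.
have bN X : bar (- X) = - bar X by rewrite -scaleN1r barZ rmorphN1 scaleN1r.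
have cci : conjc (ci R) = - ci R by apply/eqP; rewrite eq_complex /= oppr0 !eqxx.
rewrite /A; case: ifP => _; first by rewrite barD bar_U bV addrC.
by rewrite barZ cci barD bN bar_U bV scaleNr -scalerN opprB.
Qed.

Lemma frame_det q : D q -> \det (F q) = 1.
Proof.
move=> Dq; rewrite -(det1 C 4) -Fzs.
apply: (constc_of_cpd0 oD cD Dzs (smoothc_det oD sF) _ Dq) => i w Dw.
rewrite (jacobi_formula i oD sF Dw) (frame_deriv i Dw) -mulmxA mxtrace_mulC -mulmxA.
by rewrite mul_adj_mx mul_mx_scalar mxtraceZ trace_A mulr0.
Qed.

Lemma frame_adj q : D q -> F q *m \adj (F q) = 1%:M.
Proof. by move=> Dq; rewrite mul_mx_adj frame_det. Qed.

Lemma frame_unit q : D q -> F q \in unitmx.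
Proof. by move=> Dq; rewrite unitmxE frame_det// unitr1. Qed.

Lemma adj_deriv i q : D q -> cpdm i (fun w => \adj (F w)) q = - (A i q *m \adj (F q)).
Proof.
move=> Dq; have sadj := smoothcm_adj oD sF.
have := cpdmM i oD sF sadj Dq.
have -> : cpdm i (fun w => F w *m \adj (F w)) q = 0.
  rewrite (@eq_cpdm _ D _ _ i _ (fun=> 1%:M) q oD Dq) ?cpdm_cst// => w Dw.
  by apply: frame_adj; rewrite inE in Dw.
rewrite (frame_deriv i Dq) => /esym/eqP; rewrite addrC addr_eq0 => /eqP h.
apply: (can_inj (mulKmx (frame_unit Dq))).
by rewrite h mulmxN mulmxA.
Qed.

(** Both [bar F] and [F] solve the same linear system, so [bar F F^-1] has zero derivative and keeps
    its value 1 from the base point. *)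
Lemma frame_bar q : D q -> bar (F q) = F q.
Proof.
move=> Dq; have sadj := smoothcm_adj oD sF.
have sbar : smoothcm D (fun w => bar (F w)).
  apply: smoothcmM => //; last exact: smoothcm_cst.
  by apply: smoothcmM => //; [exact: smoothcm_cst|exact: smoothcm_conj].
have dbar i w : D w -> cpdm i (fun w => bar (F w)) w = bar (F w) *m A i w.
  move=> Dw; have sc := smoothcm_conj oD sF.
  rewrite /bar (cpdmM i oD _ (smoothcm_cst _ _) Dw); last first.
    by apply: smoothcmM => //; exact: smoothcm_cst.
  rewrite cpdm_cst mulmx0 addr0 (cpdmM i oD (smoothcm_cst _ _) sc Dw).
  rewrite cpdm_cst mul0mx add0r (cpdm_conj i sF Dw) (frame_deriv i Dw).
  by rewrite -/(bar (F w *m A i w)) barM bar_A.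
have M1 : bar (F q) *m \adj (F q) = 1%:M.
  have -> : 1%:M = bar (F zs) *m \adj (F zs) by rewrite Fzs bar1 adj1 mulmx1.
  apply: (constcm_of_cpdm0 oD cD Dzs (smoothcmM oD sbar sadj) _ Dq) => i w Dw.
  rewrite (cpdmM i oD sbar sadj Dw) (dbar i w Dw) (adj_deriv i Dw).
  by rewrite mulmxN mulmxA subrr.
have uadj : \adj (F q) \in unitmx by have [_] := mulmx1_unit (frame_adj Dq).
by apply: (can_inj (mulmxK uadj)); rewrite M1 (frame_adj Dq).
Qed.

Lemma frame_grpG q : D q -> grpG (F q).
Proof. by move=> Dq; apply/grpGP; rewrite frame_det// frame_bar. Qed.

Lemma gauss1E q : gauss1 F q = L *m (F q *m J *m (F q)^T) *m L^T.
Proof.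
rewrite /gauss1 /hatJ1 !trmx_mul !mulmxA (mulmxKV (mxL_unit R)).
have uLT : L^T \in unitmx by rewrite unitmx_tr mxL_unit.
have -> : (invmx L)^T = invmx L^T by rewrite trmx_inv.
by rewrite (mulmxK uLT).
Qed.

Lemma gauss1_quadrics q : D q -> quadrics (gauss1 F q).
Proof.
move=> Dq; have [B dB eF] := frame_grpG Dq.
have -> : gauss1 F q = cplx B *m hatJ1 R *m (cplx B)^T; last exact: quadrics_orbit.
have uL := mxL_unit R.
have -> : cplx B = L *m F q *m invmx L by rewrite eF !mulmxA (mulmxV uL) mul1mx (mulmxK uL).
by [].
Qed.

(** On [D] this is the logarithmic derivative [adj F . F_z] of a smooth frame, so the entries [a],
    [k] and [b] inherit smoothness. *)
Lemma smooth_U : smoothcm D U.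
Proof.
apply: (eq_smoothcm oD _ (smoothcmM oD (smoothcm_adj oD sF) (smoothcm_dzm oD sF))) => w.
rewrite inE => Dw; rewrite (Fz Dw) mulmxA (mulmx1C (frame_adj Dw)) mul1mx.
by [].
Qed.

Lemma smooth_V : smoothcm D V.
Proof.
apply: (eq_smoothcm oD _ (smoothcmM oD (smoothcm_adj oD sF) (smoothcm_dzbm oD sF))) => w.
rewrite inE => Dw; rewrite (Fzb Dw) mulmxA (mulmx1C (frame_adj Dw)) mul1mx.
by [].
Qed.

Lemma smooth_k : smoothc D k.
Proof.
apply: (eq_smoothc oD _ (smooth_U o0 o2)) => w _.
by rewrite /U matrix.mxE.
Qed.

Lemma smooth_b : smoothc D b.
Proof.
apply: (eq_smoothc oD _ (smooth_U o2 o1)) => w _.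
by rewrite /U matrix.mxE.
Qed.

Lemma maurer_cartan q : D q -> V q *m U q + dzbm U q = U q *m V q + dzm V q.
Proof.
move=> Dq; have := dzmC oD Dq sF.
have -> : dzbm (dzm F) q = dzbm (fun w => F w *m U w) q.
  by apply: (eq_dzbm oD Dq) => w; rewrite inE => Dw; exact: Fz.
have -> : dzm (dzbm F) q = dzm (fun w => F w *m V w) q.
  by apply: (eq_dzm oD Dq) => w; rewrite inE => Dw; exact: Fzb.
rewrite (dzbmM oD sF smooth_U Dq) (dzmM oD sF smooth_V Dq) (Fz Dq) (Fzb Dq).
rewrite -!mulmxA -!mulmxDr => h.
exact: (can_inj (mulKmx (frame_unit Dq)) h).
Qed.

(** The entry (0, 2) is the place to look: [V] vanishes there, and the products [V U] and [U V]
    contribute [conj(a) k] and [- conj(a) k]. *)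
Lemma kzb q : D q -> dzb k q = - (2 * conjc (a q) * k q).
Proof.
move=> Dq; have /matrixP/(_ o0 o2) := maurer_cartan Dq.
have add4 (X Y : 'M[C]_4) i j : (X + Y) i j = X i j + Y i j by rewrite matrix.mxE.
have hU : dzbm U q o0 o2 = dzb k q.
  rewrite matrix.mxE; congr (dzb _ q); apply/funext => w.
  by rewrite /U matrix.mxE.
have hV : dzm V q o0 o2 = 0.
  rewrite matrix.mxE; have -> : (fun w => V w o0 o2) = (fun=> 0).
    by apply/funext => w; rewrite /V matrix.mxE.
  by rewrite /dz !cpd_cst mulr0 subr0 mul0r.
rewrite !add4 hU hV /U /V /mxU0 /mxV0 !mx4M.
rewrite !matrix.mxE /= => /(canRL (addKr _)) ->; ring.
Qed.

Lemma kbz q : D q -> dz (fun w => conjc (k w)) q = - (2 * a q * conjc (k q)).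
Proof.
by move=> Dq; rewrite (dz_conj smooth_k Dq) kzb// conjcN !conjcM conjcK conjc_nat.
Qed.

Lemma bbz q : D q -> dz (fun w => conjc (b w)) q = 2 * a q * conjc (b q).
Proof.
by move=> Dq; rewrite (dz_conj smooth_b Dq) bzb// !conjcM conjcK conjc_nat.
Qed.

Let S q := dzbm U q + dzm V q.

Lemma S_explicit q : D q -> exists x y : C, S q = mx4
  [:: [:: x + y; - (2 * a q * conjc (k q)); - (2 * conjc (a q) * k q); 0];
      [:: 0; - x + y; 2 * a q * conjc (b q); - (2 * conjc (a q) * k q)];
      [:: 0; 2 * conjc (a q) * b q; x - y; - (2 * a q * conjc (k q))];
      [:: 0; 0; 0; - x - y]].
Proof.
move=> Dq; have sa : smoothc D a.
  by apply: (eq_smoothc oD _ (smooth_U o0 o0)) => w _; rewrite /U matrix.mxE.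
(* These derivatives stay unevaluated, since the divergence identity holds for arbitrary values of
   them. *)
exists (dzb a q), (dz (fun w => conjc (a w)) q).
have d0 (c : C) : dz (fun=> c) q = 0 by rewrite /dz !cpd_cst mulr0 subr0 mul0r.
have db0 (c : C) : dzb (fun=> c) q = 0 by rewrite /dzb !cpd_cst mulr0 addr0 mul0r.
have cN (u : R * R -> C) i : smoothc D u -> cpd i (fun w => - u w) q = - cpd i u q.
  move=> su; under eq_fun do rewrite -mulN1r.
  by rewrite (cpdM i oD (smoothc_cst _ _) su Dq) cpd_cst mul0r add0r mulN1r.
have dN : dz (fun w => - conjc (a w)) q = - dz (fun w => conjc (a w)) q.
  by rewrite /dz !cN; [field|exact: smoothc_conj..].
have dbN : dzb (fun w => - a w) q = - dzb a q by rewrite /dzb !cN//; field.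
have EU : dzbm U q = _ := dzbm_mx4 a (fun=> 0) k (fun=> 0) (fun=> 1) (fun w => - a w) (fun=> 0) k
  (fun=> 0) b a (fun=> 0) (fun=> 0) (fun=> 0) (fun=> 1) (fun w => - a w) q.
have EV : dzm V q = _ := dzm_mx4 (fun w => conjc (a w)) (fun w => conjc (k w)) (fun=> 0) (fun=> 0)
  (fun=> 0) (fun w => conjc (a w)) (fun w => conjc (b w)) (fun=> 0)
  (fun=> 1) (fun=> 0) (fun w => - conjc (a w)) (fun w => conjc (k w))
  (fun=> 0) (fun=> 1) (fun=> 0) (fun w => - conjc (a w)) q.
rewrite !d0 dN in EV; rewrite !db0 dbN in EU.
rewrite /S EU EV mx4D (kzb Dq) (kbz Dq) (bbz Dq) (bzb Dq); mx4_congr; ring.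
Qed.

(** The derivative of [F J F^T] in direction [i], stripped of the outer factors [F] and [F^T]. *)
Let W i q := A i q *m J + J *m (A i q)^T.

Let H q := F q *m J *m (F q)^T.

Lemma smooth_A i : smoothcm D (A i).
Proof.
apply: (eq_smoothcm oD _ (smoothcmM oD (smoothcm_adj oD sF) (smoothcm_cpd i sF))) => w.
rewrite inE => Dw; rewrite (frame_deriv i Dw) mulmxA (mulmx1C (frame_adj Dw)) mul1mx.
by [].
Qed.

Lemma smooth_sandwich (X : R * R -> 'M[C]_4) : smoothcm D X ->
  smoothcm D (fun w => F w *m X w *m (F w)^T).
Proof. by move=> sX; apply: smoothcmM => //; [exact: smoothcmM|exact: smoothcmT]. Qed.

Lemma sandwich_deriv i (X : R * R -> 'M[C]_4) q : smoothcm D X -> D q ->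
  cpdm i (fun w => F w *m X w *m (F w)^T) q =
  F q *m (A i q *m X q + cpdm i X q + X q *m (A i q)^T) *m (F q)^T.
Proof.
move=> sX Dq.
rewrite (cpdmM i oD (smoothcmM oD sF sX) (smoothcmT sF) Dq) (cpdmM i oD sF sX Dq).
by rewrite cpdmT (frame_deriv i Dq) trmx_mul !mulmxDr !mulmxDl !mulmxA.
Qed.

Lemma smooth_W i : smoothcm D (W i).
Proof.
have sA := smooth_A i; have sJ := smoothcm_cst D J.
apply: smoothcmD => //; apply: smoothcmM => //.
exact: smoothcmT.
Qed.

Lemma H_deriv i q : D q -> cpdm i H q = F q *m W i q *m (F q)^T.
Proof.
move=> Dq; rewrite /H (sandwich_deriv i (smoothcm_cst _ _) Dq) cpdm_cst addr0.
by [].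
Qed.

Lemma W_deriv i j q : D q ->
  cpdm j (W i) q = cpdm j (A i) q *m J + J *m (cpdm j (A i) q)^T.
Proof.
move=> Dq; have sA := smooth_A i; have sJ := smoothcm_cst D J.
rewrite (cpdmD j (smoothcmM oD sA sJ) (smoothcmM oD sJ (smoothcmT sA)) Dq).
rewrite (cpdmM j oD sA sJ Dq) (cpdmM j oD sJ (smoothcmT sA) Dq) !cpdm_cst.
by rewrite mulmx0 mul0mx addr0 add0r cpdmT.
Qed.

Lemma gauss1_fun : gauss1 F = fun w => L *m H w *m L^T.
Proof. by apply/funext => w; rewrite gauss1E. Qed.

Lemma L_sandwich_deriv i (X : R * R -> 'M[C]_4) q : smoothcm D X -> D q ->
  cpdm i (fun w => L *m X w *m L^T) q = L *m cpdm i X q *m L^T.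
Proof.
move=> sX Dq; have sc (M : 'M[C]_4) := smoothcm_cst D M.
rewrite (cpdmM i oD (smoothcmM oD (sc L) sX) (sc L^T) Dq) (cpdmM i oD (sc L) sX Dq).
by rewrite !cpdm_cst mulmx0 addr0 mul0mx add0r.
Qed.

Lemma smooth_H : smoothcm D H.
Proof. by apply: smooth_sandwich; exact: smoothcm_cst. Qed.

Lemma gauss1_smooth : smoothcm D (gauss1 F).
Proof.
rewrite gauss1_fun; apply: smoothcmM => //; last exact: smoothcm_cst.
by apply: smoothcmM => //; [exact: smoothcm_cst|exact: smooth_H].
Qed.

Lemma gauss1_deriv i q : D q ->
  cpdm i (gauss1 F) q = L *m (F q *m W i q *m (F q)^T) *m L^T.
Proof. by move=> Dq; rewrite gauss1_fun (L_sandwich_deriv i smooth_H Dq) H_deriv. Qed.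

Lemma gauss1_deriv2 i q : D q -> cpdm i (cpdm i (gauss1 F)) q =
  L *m (F q *m (A i q *m W i q + cpdm i (W i) q + W i q *m (A i q)^T) *m (F q)^T) *m L^T.
Proof.
move=> Dq; have sW := smooth_W i.
rewrite (@eq_cpdm _ D _ _ i _ (fun w => L *m (F w *m W i w *m (F w)^T) *m L^T) q oD Dq); last first.
  by move=> w; rewrite inE => Dw; rewrite gauss1_deriv.
by rewrite (L_sandwich_deriv i (smooth_sandwich sW) Dq) (sandwich_deriv i sW Dq).
Qed.

Lemma gauss1_invmx q : D q ->
  invmx (gauss1 F q) = invmx L^T *m (invmx (F q)^T *m J *m invmx (F q)) *m invmx L.
Proof.
move=> Dq; have uL := mxL_unit R; have uF := frame_unit Dq.
have uLT : L^T \in unitmx by rewrite unitmx_tr.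
have uFT : (F q)^T \in unitmx by rewrite unitmx_tr.
apply: invmx_uniq; rewrite gauss1E !mulmxA (mulmxK uLT) (mulmxK uFT).
by rewrite -(mulmxA _ J J) mxJ_mul mulmx1 (mulmxK uF) (mulmxV uL).
Qed.

(** Multiplication by the inverse of the Gauss map turns a congruence by [L F] into a conjugation,
    so traces and Christoffel terms reduce to matrices free of [F]. *)
Lemma gauss1_inv q (X : 'M[C]_4) : D q ->
  L *m (F q *m X *m (F q)^T) *m L^T *m invmx (gauss1 F q) =
  L *m (F q *m (X *m J) *m invmx (F q)) *m invmx L.
Proof.
move=> Dq; have uL := mxL_unit R.
have uLT : L^T \in unitmx by rewrite unitmx_tr.
have uFT : (F q)^T \in unitmx by rewrite unitmx_tr frame_unit.
by rewrite (gauss1_invmx Dq) !mulmxA (mulmxK uLT) (mulmxK uFT).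
Qed.

Lemma gauss1_inv2 q (X Y : 'M[C]_4) : D q ->
  L *m (F q *m X *m (F q)^T) *m L^T *m invmx (gauss1 F q) *m
    (L *m (F q *m Y *m (F q)^T) *m L^T) =
  L *m (F q *m (X *m J *m Y) *m (F q)^T) *m L^T.
Proof.
move=> Dq; rewrite (gauss1_inv _ Dq).
by rewrite !mulmxA (mulmxKV (mxL_unit R)) (mulmxKV (frame_unit Dq)).
Qed.

(** Regrouped, the left side is [(U_x + i U_y) + (V_x - i V_y)], that is [2 U_zb + 2 V_z]. *)
Lemma A_divergence q : D q -> cpdm 0 (A 0) q + cpdm 1 (A 1) q = 2 *: S q.
Proof.
move=> Dq; have sU := smooth_U; have sV := smooth_V.
have -> : A 0 = fun w => U w + V w by [].
have -> : A 1 = fun w => ci R *: (U w + -1 *: V w).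
  by apply/funext => w; rewrite scaleN1r.
have sNV := smoothcmZ (-1) oD sV.
rewrite (cpdmD 0 sU sV Dq) (cpdmZ _ _ oD Dq (smoothcmD oD sU sNV)).
rewrite (cpdmD 1 sU sNV Dq) (cpdmZ _ _ oD Dq sV) !cpdm0E !cpdm1E /S.
move: (dzm U q) (dzbm U q) (dzm V q) (dzbm V q) => X Y Z T.
apply/matrixP => i j; rewrite !matrix.mxE.
have -> : ci R * (ci R * (X i j - Y i j) + -1 * (ci R * (Z i j - T i j))) =
  ci R * ci R * (X i j - Y i j - (Z i j - T i j)) by ring.
by rewrite ci2; ring.
Qed.

Lemma gauss1_harmonic : harmonic_map D (gauss1 F).
Proof.
split; first exact: gauss1_smooth.
move=> q Dq; rewrite /tension.
(* The contribution of direction [i] to the tension after the factors [L F] and [J] are removed: a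
   commutator plus the derivative of [A i] made symmetric under [refl]. *)
pose T i : 'M[C]_4 := A i q *m refl (A i q) - refl (A i q) *m A i q +
  (cpdm i (A i) q + refl (cpdm i (A i) q)).
have Ti i : cpdm i (cpdm i (gauss1 F)) q +
    christoffel (gauss1 F q) (cpdm i (gauss1 F) q) (cpdm i (gauss1 F) q) =
    L *m (F q *m (T i *m J) *m (F q)^T) *m L^T.
  have chr (Q X : 'M[C]_4) : christoffel Q X X = - (X *m invmx Q *m X).
    rewrite /christoffel; move: (X *m invmx Q *m X) => Y.
    by apply/matrixP => r c; rewrite !matrix.mxE; field.
  rewrite chr (gauss1_deriv2 i Dq) (gauss1_deriv i Dq) (gauss1_inv2 _ _ Dq).
  rewrite -mulmxBl -mulmxBr -mulmxBl -mulmxBr; congr (L *m (F q *m _ *m (F q)^T) *m L^T).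
  rewrite W_deriv// refl_J -mulmxDl [RHS]mulmxDl -second_fundamental_form -/(W i q).
  by rewrite [X in X - _]addrAC [LHS]addrAC.
rewrite (eq_bigr _ (fun i _ => Ti i)) {Ti}.
have sum2 (g : 'I_2 -> 'M[C]_4) : \sum_i g i = g 0 + g 1.
  by rewrite big_ord_recl big_ord1; congr (g _ + g _); apply: val_inj.
rewrite sum2.
rewrite -mulmxDl -mulmxDr -mulmxDl -mulmxDr -mulmxDl.
suff -> : T 0 + T 1 = 0 by rewrite mul0mx mulmx0 mul0mx mulmx0 mul0mx.
have -> : T 0 + T 1 = A 0 q *m refl (A 0 q) - refl (A 0 q) *m A 0 q +
    (A 1 q *m refl (A 1 q) - refl (A 1 q) *m A 1 q) + 2 *: (S q + refl (S q)).
  have -> : 2 *: (S q + refl (S q)) = cpdm 0 (A 0) q + cpdm 1 (A 1) q +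
      refl (cpdm 0 (A 0) q + cpdm 1 (A 1) q).
    by rewrite (A_divergence Dq) reflZ -scalerDr.
  by rewrite reflD /T [LHS]addrACA [X in _ + X = _]addrACA.
have [x [y ->]] := S_explicit Dq.
have -> : A 1 q *m refl (A 1 q) - refl (A 1 q) *m A 1 q =
    - ((U q - V q) *m refl (U q - V q) - refl (U q - V q) *m (U q - V q)).
  exact: (refl_bracketZ _ (ci2 R)).
exact: divergence_identity.
Qed.

Lemma gauss1_conformal : conformal_map D (gauss1 F).
Proof.
move=> q Dq; rewrite /qmetric.
pose w := U q *m J + J *m (U q)^T.
have sc (M : 'M[C]_4) := smoothcm_cst D M.
have dH : dzm H q = F q *m w *m (F q)^T.
  rewrite /H (dzmM oD (smoothcmM oD sF (sc J)) (smoothcmT sF) Dq) (dzmM oD sF (sc J) Dq).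
  rewrite dzm_cst mulmx0 addr0 dzmT (Fz Dq) trmx_mul /w mulmxDr mulmxDl !mulmxA.
  by [].
have dg : dzm (gauss1 F) q = L *m (F q *m w *m (F q)^T) *m L^T.
  rewrite gauss1_fun (dzmM oD (smoothcmM oD (sc L) smooth_H) (sc L^T) Dq).
  by rewrite (dzmM oD (sc L) smooth_H Dq) !dzm_cst mulmx0 addr0 mul0mx add0r dH.
have -> (Q X : 'M[C]_4) : \tr (invmx Q *m X *m invmx Q *m X) = \tr (X *m invmx Q *m X *m invmx Q).
  by rewrite mxtrace_mulC !mulmxA.
rewrite dg (gauss1_inv2 _ _ Dq) (gauss1_inv _ Dq).
rewrite mxtrace_mulC !mulmxA (mulVmx (mxL_unit R)) mul1mx mxtrace_mulC.
rewrite !mulmxA (mulVmx (frame_unit Dq)) mul1mx.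
exact: conformality_identity.
Qed.

Let psi q := lcoset_set (@grpK R) (F q).

Lemma psi_frame q : psi q (F q).
Proof. by exists 1%:M; [exact: (grpK_group R).1|rewrite mulmx1]. Qed.

Lemma psi_smooth_lift : smooth_lift (@grpG R) (@grpK R) D psi F.
Proof. by split=> // w Dw; split=> //; exact: frame_grpG. Qed.

Lemma psi_primitive : primitive_map D psi.
Proof.
split; first split=> [q Dq|q Dq].
- by exists (F q) => //; exact: frame_grpG.
- by exists D, F; split=> //; exact: psi_smooth_lift.
move=> q Dq.
pose X := mx4 [:: [:: 0; 0; k q; 0]; [:: 1; 0; 0; k q]; [:: 0; b q; 0; 0]; [:: 0; 0; 1; 0]].
exists (F q *m X *m invmx (F q)).
  by exists (F q); [exact: psi_frame|exists X; [exact: gC_m1|]].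
exists D, F; split=> //; first exact: psi_smooth_lift.
(* The negative of the diagonal part of [U]: the representative to be tested is [X] minus the
   logarithmic derivative, that is [X - U] after conjugation. *)
pose N : 'M[C]_4 := mx4
  [:: [:: - a q; 0; 0; 0]; [:: 0; - - a q; 0; 0]; [:: 0; 0; - a q; 0]; [:: 0; 0; 0; - - a q]].
exists (F q); first exact: psi_frame.
exists N; first exact: gC_0.
rewrite (Fz Dq) -mulmxBl -mulmxBr; congr (_ *m _ *m _).
by rewrite /N /X /U /mxU0 mx4N mx4D; mx4_congr; ring.
Qed.

(** A point of the projected coset is [F c d] with [c] in [K] and [d] in [K1]; both preserve [J] and
    are absorbed, so the image is a single point. *)
Lemma psi_gauss1 q : D q -> toQ (proj_coset (@grpK1 R) (psi q)) = [set gauss1 F q].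
Proof.
move=> Dq.
have K1 c : grpK c -> c *m J *m c^T = J.
  by move=> /grpKP[k1 [k2 [_ k10 _ k20 ->]]]; exact: mxK_J.
apply/seteqP; split=> [_ [_ [_ [c Kc <-] [d [_ dJ] <-]] <-]|_ ->].
  rewrite /= gauss1E !trmx_mul.
  have -> : L *m (F q *m c *m d) *m J *m (d^T *m (c^T *m (F q)^T)) *m L^T =
      L *m (F q *m (c *m (d *m J *m d^T) *m c^T) *m (F q)^T) *m L^T by rewrite !mulmxA.
  by rewrite dJ (K1 c Kc) !mulmxA.
exists (F q); last by rewrite gauss1E !mulmxA.
exists (F q); first exact: psi_frame.
exists 1%:M; last by rewrite mulmx1.
by split; [apply/grpGP; rewrite det1 bar1|rewrite mul1mx trmx1 mulmx1].
Qed.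

End DemoulinFrame.

Theorem theorem6p1 (R : realType) (D : set (R * R))
    (S : R * R -> {vspace 'rV[R]_4}) (f : R * R -> 'rV[R]_4)
    (b p : R * R -> R[i]) (zs : R * R) (F : R * R -> 'M[R[i]]_4) :
  sc_domain D -> definite_demoulin D S f b p ->
  D zs -> wilczynski_frame D b p zs F ->
  let g1 := gauss1 F in
  [/\ forall q, D q -> quadrics (g1 q),
      conformal_map D g1,
      harmonic_map D g1,
      regular_symmetric_space 6 (@grpG R) (@lieG R) (@grpK R) (@lieK R)
        (@kappa R) (@dkappa R) &
      exists psi : R * R -> set 'M[R[i]]_4,
        primitive_map D psi /\
        forall q, D q -> toQ (proj_coset (@grpK1 R) (psi q)) = [set g1 q]].
Proof.
move=> [oD _ cD _] dem Dzs [sF Fzs FUV] g1.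
have sb := dd_smooth_b dem; have b0 := dd_metric dem; have P0 := dd_demoulin dem.
pose k := inv_k b.
(* The diagonal entry of [U]. Its conjugate is the diagonal entry of [V], and clearing the
   denominator there gives the equation for [b_zb], which is where [b] must not vanish. *)
pose a q := dz (fun w => conjc (b w)) q / (2 * conjc (b q)).
have conj_a q : D q -> conjc (a q) = dzb b q / (2 * b q).
  by move=> Dq; rewrite /a (dz_conj sb Dq); exact: conj_log_deriv.
have bzb q : D q -> dzb b q = 2 * conjc (a q) * b q.
  by move=> Dq; rewrite (conj_a q Dq); field; rewrite b0.
have Fz q : D q -> dzm F q = F q *m mxU0 (a q) (k q) (b q).
  move=> Dq; have [-> _] := FUV q Dq; congr (_ *m _).
  by rewrite /mxU (P0 q Dq) conjc0 mulr0.
have Fzb q : D q -> dzbm F q = F q *m mxV0 (conjc (a q)) (conjc (k q)) (conjc (b q)).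
  move=> Dq; have [_ ->] := FUV q Dq; congr (_ *m _).
  by rewrite /mxV (P0 q Dq) conjc0 mulr0 (conj_a q Dq).
split.
- exact: (gauss1_quadrics oD cD Dzs sF Fzs Fz Fzb).
- exact: (gauss1_conformal oD cD Dzs sF Fzs Fz Fzb).
- exact: (gauss1_harmonic oD cD Dzs sF Fzs Fz Fzb bzb).
- exact: regular_SL4.
- exists (fun q => lcoset_set (@grpK R) (F q)); split.
    exact: (psi_primitive oD cD Dzs sF Fzs Fz Fzb).
  exact: (psi_gauss1 F).
Qed.
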